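(* Let $n\ge 3$. Let $(L_i:1\le i\le n)$ be a nondegenerate $n$-tuple of surjective linear maps $L_i:\mathbb{R}^2\to\mathbb{R}$. Let $(E_i:1\le i\le n)$ be an $n$-tuple of Lebesgue measurable subsets of $\mathbb{R}$ that is admissible relative to $(L_i)$. If $$I(E_1,\dots,E_n)=I(E_1^*,\dots,E_n^* ),$$ then there exist a point $z\in\mathbb{R}^2$ and, for each index $i\in\{1,\dots,n\}$, an interval $J_i\subset\mathbb{R}$ such that $|E_i\bigtriangleup J_i|=0$ and the center point of $J_i$ equals $L_i(z)$. Conversely, $I(E_1,\dots,E_n)=I(E_1^*,\dots,E_n^* )$ in all such cases, i.e. whenever such a point $z$ and such intervals $J_i$ exist.
   Context: $|\cdot|$ denotes Lebesgue measure and $\bigtriangleup$ denotes symmetric difference. For a tuple of linear maps $L_j:\mathbb{R}^2\to\mathbb{R}$ and measurable sets $E_j\subset\mathbb{R}$, $1\le j\le n$, $$I(E_1,\dots,E_n)=\int_{\mathbb{R}^2}\prod_{j=1}^n \mathbf{1}_{E_j}(L_j(x))\,dx .$$ For a Lebesgue measurable set $E\subset\mathbb{R}$ of finite measure, $E^*$ denotes the nonempty closed interval centered at $0$ with $|E^*|=|E|$. Nondegenerate: the family $(L_j)$ of surjective linear maps $\mathbb{R}^2\to\mathbb{R}$ is nondegenerate if for every set $S\subset\{1,\dots,n\}$ of cardinality $2$, the map $x\mapsto (L_j(x):j\in S)$ from $\mathbb{R}^2$ to $\mathbb{R}^S$ is a bijection. Admissible: set $S_j^\star=\{x\in\mathbb{R}^2: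 L_j(x)\in E_j^*\}$. The tuple $(E_j:1\le j\le n)$ is admissible relative to $(L_j)$ if each $E_j$ is Lebesgue measurable with $0<|E_j|<\infty$, and there exists no index $k$ such that $S_k^\star$ contains an open neighborhood of $\bigcap_{j\ne k}S_j^\star$. *)

(* Defs.v *)
From HB Require Import structures.
From mathcomp Require Import all_boot all_order all_algebra.
From mathcomp Require Import all_classical all_reals all_analysis.
From mathcomp Require Import ring lra.
Set Implicit Arguments.
Unset Strict Implicit.
Unset Printing Implicit Defensive.
Import Order.TTheory GRing.Theory Num.Theory.
Import numFieldNormedType.Exports.
Local Open Scope classical_set_scope.
Local Open Scope ring_scope.

(* [R^o] is [R] seen as a module over itself, so that [plane R] is a normed
   [R]-module (with the product topology). *)
Notation plane R := (R^o * R^o)%type.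

(* Lebesgue (not merely Borel) measurable subsets of the line: this is the
   sigma-algebra on which [completed_lebesgue_measure] is a measure. *)
Definition lebesgue_measurable (R : realType) (A : set R) : Prop :=
  ((@wlength R idfun)^*%mu).-cara.-measurable A.

(* Lebesgue measure on the plane: [lebesgue_measure \x lebesgue_measure] is only
   a measure on Borel sets; its Caratheodory extension is complete, so that the
   preimage of a Lebesgue measurable set by a surjective linear form is
   measurable. *)
Definition lebesgue_measure2 {R : realType} :=
  @completed_measure_extension _ _ R
    (@lebesgue_measure R \x @lebesgue_measure R)%E.
HB.instance Definition _ (R : realType) := Measure.on (@lebesgue_measure2 R).

Definition multiform (R : realType) (n : nat)
    (L : 'I_n -> {linear plane R -> R^o}) (E : 'I_n -> set R) : \bar R :=
  (\int[lebesgue_measure2]_x (\prod_(j < n) \1_(E j) (L j x))%:E)%E.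

(* The closed interval centered at [0] with the measure of [E]; meaningful when
   [E] has finite measure. *)
Definition rearrangement (R : realType) (E : set R) : set R :=
  let r := fine (completed_lebesgue_measure E) / 2 in `[- r, r].

Lemma completed_lebesgue_measure_rearrangement (R : realType) (E : set R) :
  (completed_lebesgue_measure E < +oo)%E ->
  completed_lebesgue_measure (rearrangement E) = completed_lebesgue_measure E.
Proof.
move=> Efin; have mE0 : (0 <= completed_lebesgue_measure E)%E.
  exact: outer_measure_ge0.
have Efn : completed_lebesgue_measure E \is a fin_num by rewrite ge0_fin_numE.
rewrite /rearrangement.
set r := fine _ / 2.
have r0 : 0 <= r by rewrite divr_ge0// fine_ge0.
rewrite -[LHS]/(lebesgue_measure (`[- r, r]%classic : set R)).
rewrite lebesgue_measure_itv /= lte_fin.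
case: ifPn => [_|]; rewrite -[in RHS](fineK Efn).
  by rewrite -EFinB opprK -splitr.
rewrite -leNgt => rr; congr EFin; apply/eqP.
have : r = 0 by lra.
by rewrite /r => /eqP; rewrite mulf_eq0 invr_eq0 pnatr_eq0 orbF eq_sym.
Qed.

Definition nondegenerate_family (R : realType) (n : nat)
    (L : 'I_n -> {linear plane R -> R^o}) : Prop :=
  forall S : {set 'I_n}, #|S| = 2%N ->
    bijective (fun x : plane R => [ffun j : {j | j \in S} => L (val j) x]).

Definition strip (R : realType) (n : nat)
    (L : 'I_n -> {linear plane R -> R^o}) (E : 'I_n -> set R) (j : 'I_n) :
    set (plane R) :=
  [set x | rearrangement (E j) (L j x)].

Definition admissible (R : realType) (n : nat)
    (L : 'I_n -> {linear plane R -> R^o}) (E : 'I_n -> set R) : Prop :=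
  (forall j, [/\ lebesgue_measurable (E j),
     (0 < completed_lebesgue_measure (E j))%E &
     (completed_lebesgue_measure (E j) < +oo)%E]) /\
  ~ exists k : 'I_n, exists U : set (plane R),
      [/\ open U, \bigcap_(j in [set j | j != k]) strip L E j `<=` U &
          U `<=` strip L E k].

(* [J] is a nonempty bounded interval, of any kind (open, closed or half-open),
   with center [c]. *)
Definition interval_centered_at (R : realType) (c : R) (J : set R) : Prop :=
  [/\ is_interval J, has_inf J, has_sup J & c = (inf J + sup J) / 2].

(* Main.v *)
(* Fix an index k and slice the plane by the lines on which L_k is constant.
   Remove from every E_j, j <> k, two tails, chosen so that along these lines each
   tail has measure T.  A slice of the intersection of the sets L_j^-1(E_j) then
   loses at most 2 T, whereas for the intervals E_j^* it loses exactly 2 T as long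
   as it is at least that long.  For the critical T, the strip S_k^* becomes
   redundant: E_k can be dropped, and the inequality I(E) <= I( E^* ) follows by
   induction on the number of sets.

   If equality holds, the trimmed sets E_j, j <> k, are again a case of equality,
   hence intervals centered at L_j(z), and E_k, which was not trimmed, has to fill
   the interval of the values of L_k on their polygon.  As k is arbitrary, all the
   sets are intervals, and trimming intervals does not move their centers.

   The induction stops at two sets A, B (up to scaling) whose essential sumset is
   contained in a set C with |C| <= |A| + |B|.  Then |C| = |A| + |B|, and the
   functions F_X(t) = |X n (-oo, t)| satisfy F_C(x + y) = F_A(x) + F_B(y) wherever
   0 < F_A(x) < |A| and 0 < F_B(y) < |B|.  Comparing increments near a density
   point, F_A and F_B have slope 1, so A and B are intervals. *)
Require Import Defs.
From mathcomp Require Import all_boot all_order all_algebra.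
From mathcomp Require Import all_classical all_reals all_analysis.
From mathcomp Require Import measurable_realfun ring lra.
Set Implicit Arguments.
Unset Strict Implicit.
Unset Printing Implicit Defensive.
Import Order.TTheory GRing.Theory Num.Theory.
Import numFieldNormedType.Exports.
Local Open Scope classical_set_scope.
Local Open Scope ring_scope.

(** The length of a slice of the polygon cut out by the strips of index j <> k is an even concave
    function of the value s of L_k (negative values standing for empty slices). Its comparison with
    2 T at s = h_k, the half-width of E_k, therefore decides on which side of 2 T it lies for all
    |s| < h_k and all |s| > h_k.

    Admissibility enters as a closed condition: every line L_k = h_k meets the polygon, possibly in
    a vertex only. Such a point x is used twice. It gives |C| <= |A| + |B| at the bottom of the
    induction, and it shows that the values of L_k on the polygon reach out to h_k.

    The obstacle is to keep the trimmed tuple admissible. Points on the sides move along with the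
    trimming, but a half-width could drop to 0. If some index has depth T = 0, that index alone
    finishes the proof, as nothing is trimmed. Otherwise all depths are positive, and the positive
    depth of a third index keeps the half-widths positive.

    Volumes are computed with the product measure on Borel sets, each E_j being replaced by a Borel
    subset of full measure. *)

(** * Affine changes of variables on the line and in the plane *)

Section affine_change_of_variables.
Context {R : realType}.
Local Notation mu := (@lebesgue_measure R).
Local Notation mu2 := (@lebesgue_measure R \x @lebesgue_measure R)%E.
Implicit Types (A : set (measurableTypeR R)).
Implicit Types (D : set (measurableTypeR R * measurableTypeR R)).

Lemma measurable_affine (a b : R) :
  measurable_fun setT (fun t : measurableTypeR R => a + b * t : measurableTypeR R).
Proof.
have : measurable_fun setT (fun t : R => a + b * t).
  by apply: measurable_funD => //; apply: measurable_funM.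
by [].
Qed.

(** By uniqueness of Lebesgue measure it suffices that [|b|] times the pushforward agrees with it on
    half-open intervals. For negative [b] the preimage is half-open on the other side, with the same
    length. *)
Lemma lebesgue_measure_affine (a b : R) A : b != 0 -> measurable A ->
  mu [set t | A (a + b * t)] = (`|b|^-1%:E * mu A)%E.
Proof.
move=> b0 mA.
pose f : measurableTypeR R -> measurableTypeR R := fun t => a + b * t.
have mf : measurable_fun setT f := measurable_affine a b.
have bpos : 0 < `|b| by rewrite normr_gt0.
pose nb : {nonneg R} := NngNum (ltW bpos).
have [nu nuE] : exists nu : {measure set (measurableTypeR R) -> \bar R},
    forall X, nu X = (`|b|%:E * mu (f @^-1` X))%E.
  unshelve eexists (mscale nb (pushforward mu f)); first exact: mf.
  by [].
have H : mu A = nu A.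
  apply: lebesgue_measure_unique => // X [[x y]] _ <-; rewrite nuE /=.
  have [b1|b1] := ltP 0 b.
    rewrite (_ : f @^-1` _ = [set` `](x - a) / b, (y - a) / b]]); last first.
      apply/seteqP; split => t /=; rewrite !in_itv /=;
        by rewrite ltr_pdivrMr// ler_pdivlMr// ltrBlDl lerBrDl mulrC.
    rewrite !lebesgue_measure_itv /= !lte_fin ltr_pM2r ?invr_gt0//.
    rewrite ltrD2r; case: ifP => _; last by rewrite mule0.
    by rewrite -!EFinB -EFinM gtr0_norm//; congr EFin; field.
  have {}b1 : b < 0 by rewrite lt_neqAle b0.
  rewrite (_ : f @^-1` _ = [set` `[(y - a) / b, (x - a) / b[]); last first.
    apply/seteqP; split => t /=; rewrite !in_itv /=;
      rewrite ltr_ndivlMr// ler_ndivrMr// ltrBlDl lerBrDl mulrC andbC;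
      by case/andP => -> ->.
  rewrite !lebesgue_measure_itv /= !lte_fin ltr_nM2r ?invr_lt0//.
  rewrite ltrD2r; case: ifP => _; last by rewrite mule0.
  by rewrite -!EFinB -EFinM ltr0_norm//; congr EFin; field.
by rewrite H nuE muleA -EFinM mulVf ?gt_eqF// mul1e.
Qed.

Lemma xsectionE (T1 T2 : Type) (D : set (T1 * T2)) x :
  xsection D x = [set y | D (x, y)].
Proof. by apply/seteqP; split => y; rewrite /xsection /= inE. Qed.

Lemma ysectionE (T1 T2 : Type) (D : set (T1 * T2)) y :
  ysection D y = [set x | D (x, y)].
Proof. by apply/seteqP; split => x; rewrite /ysection /= inE. Qed.

Lemma mu2_xE D : mu2 D = (\int[mu]_x mu [set y | D (x, y)])%E.
Proof. by apply: eq_integral => x _ /=; rewrite xsectionE. Qed.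

Lemma mu2_yE D : measurable D ->
  mu2 D = (\int[mu]_y mu [set x | D (x, y)])%E.
Proof.
move=> mD; have := indic_fubini_tonelli mu mu mD.
rewrite indic_fubini_tonelli_FE// indic_fubini_tonelli_GE// => H.
rewrite -[LHS]/(\int[mu]_x (mu \o xsection D) x)%E H.
by apply: eq_integral => x _ /=; rewrite ysectionE.
Qed.

Lemma measurable_mu_x D : measurable D ->
  measurable_fun setT (fun x => mu [set y | D (x, y)]).
Proof.
move=> /(measurable_fun_xsection mu) mD; apply: eq_measurable_fun mD => x _ /=.
by rewrite xsectionE.
Qed.

Lemma measurable_mu_y D : measurable D ->
  measurable_fun setT (fun y => mu [set x | D (x, y)]).
Proof.
move=> /(measurable_fun_ysection mu) mD; apply: eq_measurable_fun mD => x _ /=.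
by rewrite ysectionE.
Qed.

Lemma measurable_x D x : measurable D -> measurable [set y | D (x, y)].
Proof. by move=> mD; rewrite -xsectionE; exact: measurable_xsection. Qed.

Lemma measurable_y D y : measurable D -> measurable [set x | D (x, y)].
Proof. by move=> mD; rewrite -ysectionE; exact: measurable_ysection. Qed.

Lemma measurable_form (c p q : R) :
  measurable_fun setT (fun z : measurableTypeR R * measurableTypeR R =>
    c + p * z.1 + q * z.2 : measurableTypeR R).
Proof.
have H1 : measurable_fun setT
   (fst : measurableTypeR R * measurableTypeR R -> measurableTypeR R).
  exact: measurable_fst.
have H2 : measurable_fun setT
   (snd : measurableTypeR R * measurableTypeR R -> measurableTypeR R).
  exact: measurable_snd.
apply: (@measurable_funD _ _ R setT (fun z => c + p * z.1)).
  by apply: measurable_funD => //; exact: measurable_funM.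
exact: measurable_funM.
Qed.

Lemma measurable_affine2 (c p q d r s : R) D : measurable D ->
  measurable [set z | D (c + p * z.1 + q * z.2, d + r * z.1 + s * z.2)].
Proof.
move=> mD; rewrite -[X in measurable X]setTI.
apply: (measurable_fun_pair (measurable_form c p q) (measurable_form d r s)) => //.
Qed.

Lemma mu2_row (c r s : R) D : s != 0 -> measurable D ->
  mu2 [set z | D (z.1, c + r * z.1 + s * z.2)] = (`|s|^-1%:E * mu2 D)%E.
Proof.
move=> s0 mD; rewrite !mu2_xE -ge0_integralZl//; last exact: measurable_mu_x.
  apply: eq_integral => x _ /=.
  by rewrite (lebesgue_measure_affine (c + r * x) s0 (measurable_x x mD)).
Qed.

Lemma mu2_col (c p q : R) D : p != 0 -> measurable D ->
  mu2 [set z | D (c + p * z.1 + q * z.2, z.2)] = (`|p|^-1%:E * mu2 D)%E.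
Proof.
move=> p0 mD.
have mD' : measurable [set z | D (c + p * z.1 + q * z.2, z.2)].
  have := measurable_affine2 c p q 0 0 1 mD.
  congr (measurable _); apply/seteqP; split=> z /=; by rewrite mul0r !add0r mul1r.
rewrite !mu2_yE// -ge0_integralZl//; last exact: measurable_mu_y.
  apply: eq_integral => y _ /=.
  rewrite -(lebesgue_measure_affine (c + q * y) p0 (measurable_y y mD)).
  by congr (mu _); apply/seteqP; split=> t /=; rewrite addrAC.
Qed.

Lemma mu2_swap D : measurable D -> mu2 [set z | D (z.2, z.1)] = mu2 D.
Proof. by move=> mD; rewrite (mu2_yE mD) mu2_xE. Qed.

(** If [p] is nonzero, the map is a change of the first variable followed by a change of the second.
    If [p = 0], then [q] is nonzero and exchanging the variables reduces to this case. *)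
Lemma mu2_affine (c d p q r s : R) D : p * s - q * r != 0 -> measurable D ->
  mu2 [set z | D (c + p * z.1 + q * z.2, d + r * z.1 + s * z.2)] =
  (`|p * s - q * r|^-1%:E * mu2 D)%E.
Proof.
move=> det mD.
have main (p' q' r' s' : R) : p' != 0 -> p' * s' - q' * r' != 0 ->
    mu2 [set z | D (c + p' * z.1 + q' * z.2, d + r' * z.1 + s' * z.2)] =
    (`|p' * s' - q' * r'|^-1%:E * mu2 D)%E.
  move=> p0 {det} det.
  (* [e] and [u] express the second coordinate through the new first one; [p' * u] is the
     determinant. *)
  pose u := (p' * s' - q' * r') / p'.
  pose e := d - c * r' / p'.
  pose D1 := [set z | D (z.1, e + (r' / p') * z.1 + u * z.2)].
  have u0 : u != 0 by rewrite mulf_neq0// invr_eq0.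
  have mD1 : measurable D1.
    have := measurable_affine2 0 1 0 e (r' / p') u mD.
    congr (measurable _); apply/seteqP; split=> z /=;
      by rewrite mul0r add0r addr0 mul1r.
  transitivity (mu2 [set z | D1 (c + p' * z.1 + q' * z.2, z.2)]).
    congr (mu2 _); apply/seteqP; split => z;
      rewrite /D1 /=; congr (D (_, _)); rewrite /e /u; by field.
  rewrite mu2_col// mu2_row// muleA -EFinM; congr (_%:E * _)%E.
  by rewrite -invfM -normrM; congr (`| _ |^-1); rewrite /u; field.
have [p0|p0] := eqVneq p 0; last exact: main.
have q0 : q != 0 by apply: contraNneq det => ->; rewrite p0; apply/eqP; ring.
have mD' := measurable_affine2 c p q d r s mD.
rewrite -mu2_swap//.
transitivity (mu2 [set z | D (c + q * z.1 + p * z.2, d + s * z.1 + r * z.2)]).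
  by congr (mu2 _); apply/seteqP; split => z /=;
     rewrite [c + _ + _]addrAC [d + _ + _]addrAC.
rewrite main//; last by rewrite -oppr_eq0 opprB.
by rewrite -normrN opprB.
Qed.

End affine_change_of_variables.

(** * The distribution function of a set of finite measure, and its tails *)

Section distribution_function.
Context {R : realType}.
Local Notation mu := (@lebesgue_measure R).
Implicit Types A : set (measurableTypeR R).

Definition mass A : R := fine (mu A).

Definition left_mass A (x : R) : R := mass (A `&` `]-oo, x[).

Definition finite_borel A := measurable A /\ (mu A < +oo)%E.

Lemma massE A : finite_borel A -> mu A = (mass A)%:E.
Proof. by move=> [mA Afin]; rewrite /mass fineK// ge0_fin_numE. Qed.

Lemma mass_ge0 A : 0 <= mass A.
Proof. exact/fine_ge0/measure_ge0. Qed.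

Lemma finite_borelS A B : finite_borel A -> measurable B -> B `<=` A ->
  finite_borel B.
Proof.
move=> [mA Afin] mB BA; split=> //; apply: le_lt_trans Afin.
by apply: le_measure => //; rewrite inE.
Qed.

Lemma finite_borelI A B : finite_borel A -> measurable B ->
  finite_borel (A `&` B).
Proof.
move=> fA mB; apply: (finite_borelS fA); last exact: subIsetl.
by apply: measurableI => //; case: fA.
Qed.

Lemma finite_borelD A B : finite_borel A -> measurable B ->
  finite_borel (A `\` B).
Proof.
move=> fA mB; apply: (finite_borelS fA); last exact: subDsetl.
by apply: measurableD => //; case: fA.
Qed.

Lemma massS A B : measurable A -> finite_borel B -> A `<=` B -> mass A <= mass B.
Proof.
move=> mA fB AB; have fA := finite_borelS fB mA AB.
rewrite -lee_fin -!massE//; apply: le_measure; rewrite ?inE//.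
by case: fB.
Qed.

Lemma massDI A B : finite_borel A -> measurable B ->
  mass A = mass (A `\` B) + mass (A `&` B).
Proof.
move=> fA mB; apply: EFin_inj; rewrite EFinD -!massE//.
- by apply: measureDI => //; case: fA.
- exact: finite_borelI.
- exact: finite_borelD.
Qed.

Lemma mass_itv (i : interval R) (a b : R) (x y : bool) :
  i = Interval (BSide x a) (BSide y b) -> a <= b -> mass [set` i] = b - a.
Proof.
move=> -> ab; rewrite /mass lebesgue_measure_itv /= lte_fin.
have [->|ltab] := eqVneq a b; first by rewrite ltxx subrr.
by rewrite lt_neqAle ltab ab.
Qed.

Lemma left_mass_split A x y : finite_borel A -> x <= y ->
  left_mass A y = left_mass A x + mass (A `&` `[x, y[).
Proof.
move=> fA xy.
have fAy : finite_borel (A `&` `]-oo, y[) by exact: finite_borelI.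
rewrite /left_mass (@massDI (A `&` `]-oo, y[) `[x, +oo[)//; congr (mass _ + mass _).
  apply/seteqP; split => z /=; rewrite !in_itv /= ?andbT.
    by move=> [[Az zy] /negP]; rewrite -ltNge.
  move=> [Az zx]; split; first by split=> //; exact: lt_le_trans xy.
  by apply/negP; rewrite -ltNge.
apply/seteqP; split => z /=; rewrite !in_itv /= ?andbT.
  by move=> [[Az zy] xz]; split=> //; rewrite xz.
by move=> [Az /andP[xz zy]].
Qed.

Lemma right_massE A x : finite_borel A ->
  mass (A `&` `[x, +oo[) = mass A - left_mass A x.
Proof.
move=> fA; rewrite (@massDI A `[x, +oo[)// /left_mass.
suff -> : A `\` `[x, +oo[ = A `&` `]-oo, x[ by rewrite addrAC subrr add0r.
apply/seteqP; split => z /=; rewrite !in_itv /= ?andbT.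
  by move=> [Az /negP]; rewrite -ltNge.
by move=> [Az zx]; split=> //; apply/negP; rewrite -ltNge.
Qed.

Lemma left_mass_nd A x y : finite_borel A -> x <= y ->
  left_mass A x <= left_mass A y.
Proof. by move=> fA xy; rewrite (left_mass_split fA xy) lerDl mass_ge0. Qed.

Lemma left_mass_lip A x y : finite_borel A -> x <= y ->
  left_mass A y - left_mass A x <= y - x.
Proof.
move=> fA xy; rewrite (left_mass_split fA xy) addrAC subrr add0r.
rewrite -(@mass_itv `[x, y[ x y true true)//.
have fxy : finite_borel `[x, y[%classic.
  split; first exact: measurable_itv.
  by rewrite lebesgue_measure_itv /=; case: ifP => _; rewrite ?ltry// -EFinB ltry.
apply: massS => //.
by case: (finite_borelI fA (measurable_itv `[x, y[)).
Qed.

Lemma left_mass_continuous A : finite_borel A -> continuous (left_mass A).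
Proof.
move=> fA x; apply/cvgrPdist_le => e e0; near=> y.
have : `|x - y| <= e by near: y; exact: cvgr_dist_le.
apply: le_trans; have [xy|/ltW yx] := leP x y.
  rewrite distrC [leRHS]distrC !ger0_norm ?subr_ge0//.
    exact: left_mass_lip.
  exact: left_mass_nd.
rewrite !ger0_norm ?subr_ge0//; first exact: left_mass_lip.
exact: left_mass_nd.
Unshelve. all: by end_near. Qed.

Lemma left_mass_pinfty A e : finite_borel A -> 0 < e ->
  exists x, mass A - e < left_mass A x.
Proof.
move=> fA e0; have [mA _] := fA.
pose F n := A `&` `]-oo, n%:R[%classic : set (measurableTypeR R).
have fF n : finite_borel (F n) by exact: finite_borelI.
have : mu (F n) @[n --> \oo] --> mu (\bigcup_n F n).
  apply: nondecreasing_cvg_mu.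
  - by move=> n; case: (fF n).
  - by apply: bigcup_measurable => n _; case: (fF n).
  - move=> m n mn; apply/subsetPset; apply: setIS => z /=; rewrite !in_itv /=.
    by move=> zm; apply: lt_le_trans zm _; rewrite ler_nat.
have -> : \bigcup_n F n = A.
  apply/seteqP; split => [z [n _ []]//|z Az].
  exists (Num.truncn `|z|).+1 => //; split=> //=; rewrite in_itv /=.
  exact: le_lt_trans (ler_norm _) (truncnS_gt _).
rewrite (massE fA) => H.
have {}H : mass (F n) @[n --> \oo] --> mass A.
  by move/fine_cvgP: H => [_]; apply: cvg_trans; apply: near_eq_cvg; near=> n.
move/cvgrPdist_lt: H => /(_ e e0) [N _ /(_ N (leqnn _)) /=].
rewrite ltr_norml => /andP[_ HN].
by exists N%:R; rewrite ltrBlDr addrC -ltrBlDr.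
Unshelve. all: by end_near. Qed.

Lemma left_mass_ninfty A e : finite_borel A -> 0 < e ->
  exists x, left_mass A x < e.
Proof.
move=> fA e0; have [mA _] := fA.
pose F n := A `&` `[- n%:R, +oo[%classic : set (measurableTypeR R).
have fF n : finite_borel (F n) by exact: finite_borelI.
have : mu (F n) @[n --> \oo] --> mu (\bigcup_n F n).
  apply: nondecreasing_cvg_mu.
  - by move=> n; case: (fF n).
  - by apply: bigcup_measurable => n _; case: (fF n).
  - move=> m n mn; apply/subsetPset; apply: setIS => z /=; rewrite !in_itv /= !andbT.
    by apply: le_trans; rewrite lerN2 ler_nat.
have -> : \bigcup_n F n = A.
  apply/seteqP; split => [z [n _ []]//|z Az].
  exists (Num.truncn `|z|).+1 => //; split=> //=; rewrite in_itv /= andbT.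
  rewrite lerNl; apply: ltW; apply: le_lt_trans (truncnS_gt _).
  by rewrite -normrN ler_norm.
rewrite (massE fA) => H.
have {}H : mass (F n) @[n --> \oo] --> mass A.
  by move/fine_cvgP: H => [_]; apply: cvg_trans; apply: near_eq_cvg; near=> n.
move/cvgrPdist_lt: H => /(_ e e0) [N _ /(_ N (leqnn _)) /=].
rewrite ltr_norml => /andP[_].
rewrite /F right_massE// opprB addrC subrK => HN.
by exists (- N%:R).
Unshelve. all: by end_near. Qed.

Lemma left_mass_ivt A t : finite_borel A -> 0 < t < mass A ->
  exists x, left_mass A x = t.
Proof.
move=> fA /andP[t0 tA].
have [x xt] := left_mass_ninfty fA t0.
have [y] : exists y, mass A - (mass A - t) < left_mass A y.
  by apply: left_mass_pinfty => //; rewrite subr_gt0.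
rewrite opprB addrC subrK => ty.
have xy : x <= y.
  rewrite leNgt; apply/negP => /ltW /(left_mass_nd fA).
  by apply/negP; rewrite -ltNge; exact: lt_trans ty.
have [||c _ <-] := @IVT R (left_mass A) x y t xy; last by exists c.
  exact/continuous_subspaceT/left_mass_continuous.
rewrite ge_min le_max (ltW xt) (ltW ty) /=.
by rewrite orbT.
Qed.

Definition down_set (D : set R) := forall x y, D y -> x <= y -> D x.
Definition up_set (U : set R) := forall x y, U x -> x <= y -> U y.

Lemma trim_exists A t : finite_borel A -> 0 <= t -> 2 * t <= mass A ->
  exists D U : set (measurableTypeR R),
    [/\ measurable D, measurable U, down_set D, up_set U &
     [/\ mass (A `&` D) = t, mass (A `&` U) = t &
         mass (A `\` (D `|` U)) = mass A - 2 * t]].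
Proof.
(* For [t = 0] there may be no quantile, as [A] can be unbounded; empty tails are used instead. *)
move=> fA; rewrite le_eqVlt => /orP[/eqP <-|t0 tA].
  move=> _; exists set0, set0; split => //.
  by rewrite !setI0 setU0 setD0 /mass measure0 mulr0 subr0.
have [d dE] : exists x, left_mass A x = t.
  by apply: left_mass_ivt => //; rewrite t0 /=; lra.
have [u' u'E] : exists x, left_mass A x = mass A - t.
  by apply: left_mass_ivt => //; apply/andP; split; lra.
have [u uE du] : exists2 u, left_mass A u = mass A - t & d <= u.
  (* The quantile [u'] can lie to the left of [d] only if [2 * t = mass A]; then [d] has both levels
     at once. *)
  have [du|ud] := leP d u'; first by exists u'.
  exists d => //; apply/eqP; rewrite eq_le; apply/andP; split.
    by rewrite dE; lra.
  by rewrite -u'E; apply: left_mass_nd => //; exact: ltW.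
exists `]-oo, d[%classic, `[u, +oo[%classic; split.
- exact: measurable_itv.
- exact: measurable_itv.
- by move=> x y /=; rewrite !in_itv /= => yd xy; exact: le_lt_trans yd.
- by move=> x y /=; rewrite !in_itv /= !andbT => ux xy; exact: le_trans xy.
have H1 : mass (A `&` `]-oo, d[) = t by [].
have H2 : mass (A `&` `[u, +oo[) = t by rewrite right_massE// uE; lra.
split=> //.
have -> : A `\` (`]-oo, d[%classic `|` `[u, +oo[%classic) = A `&` `[d, u[.
  apply/seteqP; split => z /=; rewrite !in_itv /= ?andbT.
    move=> [Az /not_orP[/negP + /negP]]; rewrite -leNgt -ltNge => dz zu.
    by rewrite dz zu.
  move=> [Az /andP[dz zu]]; split=> //; apply/not_orP; split; apply/negP.
    by rewrite -leNgt.
  by rewrite -ltNge.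
have := left_mass_split fA du; rewrite dE uE; lra.
Qed.

End distribution_function.

(** * Removing tails from a finite intersection of subsets of the line *)

Section trimming_intersections.
Context {R : realType} {I : finType}.
Local Notation mu := (@lebesgue_measure R).
Implicit Types (J : {set I}) (G D U : I -> set (measurableTypeR R)).

(** A general total preorder serves both the tails, nested by inclusion, and real-valued
    functions. *)
Lemma chain_max J (r : I -> I -> Prop) : (forall i j, r i j \/ r j i) ->
  (forall i j k, r i j -> r j k -> r i k) -> (exists j, j \in J) ->
  exists2 i, i \in J & forall j, j \in J -> r j i.
Proof.
move=> tot tr [j0 j0J].
have rr i : r i i by case: (tot i i).
suff H (s : seq I) : s != [::] -> exists2 i, i \in s & forall j, j \in s -> r j i.
  have [|i] := H (enum J).
    by apply/eqP => s0; move: j0J; rewrite -mem_enum s0.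
  rewrite mem_enum => iJ ri; exists i => // j jJ; apply: ri.
  by rewrite mem_enum.
elim: s => // i s IH _; have [->|s0] := eqVneq s [::].
  by exists i; rewrite ?mem_head// => j; rewrite inE => /eqP ->.
have [m ms mH] := IH s0.
have [im|mi] := tot i m.
  exists m; first by rewrite inE ms orbT.
  by move=> j; rewrite inE => /orP[/eqP -> //|/mH].
exists i; first by rewrite mem_head.
move=> j; rewrite inE => /orP[/eqP -> //|/mH jm]; exact: tr mi.
Qed.

Lemma real_max J (f : I -> R) : (exists j, j \in J) ->
  exists2 i, i \in J & forall j, j \in J -> f j <= f i.
Proof.
apply: (@chain_max J (fun i j => f i <= f j)).
  by move=> i j; apply/orP; exact: le_total.
by move=> i j k; exact: le_trans.
Qed.

Lemma real_min J (f : I -> R) : (exists j, j \in J) ->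
  exists2 i, i \in J & forall j, j \in J -> f i <= f j.
Proof.
move=> /(@real_max J (fun i => - f i))[i iJ H]; exists i => // j /H.
by rewrite lerN2.
Qed.

Lemma down_set_total (D D' : set R) : down_set D -> down_set D' ->
  D `<=` D' \/ D' `<=` D.
Proof.
move=> dD dD'; have [?|/existsNP[x /not_implyP[Dx D'x]]] := pselect (D `<=` D').
  by left.
right => y D'y; apply: (dD _ x) => //; rewrite leNgt; apply/negP => /ltW xy.
by apply: D'x; exact: dD' xy.
Qed.

Lemma up_set_total (D D' : set R) : up_set D -> up_set D' ->
  D `<=` D' \/ D' `<=` D.
Proof.
move=> dD dD'; have [?|/existsNP[x /not_implyP[Dx D'x]]] := pselect (D `<=` D').
  by left.
right => y D'y; apply: (dD x) => //; rewrite leNgt; apply/negP => /ltW xy.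
by apply: D'x; exact: dD' xy.
Qed.

Lemma measurable_meet J G : (forall j, measurable (G j)) ->
  measurable (\bigcap_(j in [set` J]) G j).
Proof. by move=> mG; apply: fin_bigcap_measurable. Qed.

(* The removed left tails are nested, so all of them together remove from the
   intersection no more than the largest one does; likewise on the right. *)
Lemma measure_meet_trim J G D U (T : R) : (exists j, j \in J) ->
  (forall j, measurable (G j)) -> (forall j, measurable (D j)) ->
  (forall j, measurable (U j)) ->
  (forall j, down_set (D j)) -> (forall j, up_set (U j)) ->
  (forall j, j \in J -> mu (G j `&` D j) <= T%:E)%E ->
  (forall j, j \in J -> mu (G j `&` U j) <= T%:E)%E ->
  (mu (\bigcap_(j in [set` J]) G j) <=
   (2 * T)%:E + mu (\bigcap_(j in [set` J]) (G j `\` (D j `|` U j))))%E.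
Proof.
move=> J0 mG mD mU dD uU GD GU.
have [i iJ Di] : exists2 i, i \in J & forall j, j \in J -> D j `<=` D i.
  apply: chain_max => // [i j|i j k]; first exact: down_set_total.
  exact: subset_trans.
have [l lJ Ul] : exists2 i, i \in J & forall j, j \in J -> U j `<=` U i.
  apply: chain_max => // [a b|a b c]; first exact: up_set_total.
  exact: subset_trans.
set M := \bigcap_(j in _) (_ `\` _).
have mM : measurable M.
  by apply: measurable_meet => j; apply: measurableD => //; exact: measurableU.
have mi : measurable (G i `&` D i) by exact: measurableI.
have ml : measurable (G l `&` U l) by exact: measurableI.
apply: (@le_trans _ _ (mu ((G i `&` D i) `|` (G l `&` U l) `|` M))).
  apply: le_measure; rewrite ?inE.
  - exact: measurable_meet.
  - by apply: measurableU => //; exact: measurableU.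
  move=> t Gt.
  have [Dit|nD] := pselect (D i t); first by left; left; split=> //; exact: Gt.
  have [Ult|nU] := pselect (U l t); first by left; right; split=> //; exact: Gt.
  right => j jJ; split; first exact: Gt.
  by case=> [/(Di _ jJ)|/(Ul _ jJ)].
apply: (@le_trans _ _ (mu (G i `&` D i `|` G l `&` U l) + mu M)%E).
  by apply: measureU2 => //; exact: measurableU.
apply: leeD => //; apply: (le_trans (measureU2 _ _ _)) => //.
by rewrite mulrDl mul1r EFinD; apply: leeD; [exact: GD|exact: GU].
Qed.

End trimming_intersections.

(** * Intersections of slabs in the plane and their slices *)

Section slabs.
Context {R : realType} {I : finType}.
Variables (p q : I -> R).
Local Notation mu := (@lebesgue_measure R).
Local Notation mu2 := (@lebesgue_measure R \x @lebesgue_measure R)%E.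
Local Notation T1 := (measurableTypeR R).
Implicit Types (S J : {set I}) (E : I -> set T1) (i j k : I).

Definition lform j (z : T1 * T1) : T1 := p j * z.1 + q j * z.2.

Definition slab S E : set (T1 * T1) := \bigcap_(j in [set` S]) (lform j @^-1` E j).

Definition vol S E : \bar R := mu2 (slab S E).

(* In the orthogonal basis [v = (p k, q k) / (p k ^+ 2 + q k ^+ 2)] and
   [w = (- q k, p k)], of determinant [1], [lform k] is the first coordinate and
   [lform j] has coefficients [along k j] and [across k j]. *)
Definition along k j : R := (p j * p k + q j * q k) / (p k ^+ 2 + q k ^+ 2).
Definition across k j : R := q j * p k - p j * q k.

Definition fiber k J E (s : R) : set T1 :=
  \bigcap_(j in [set` J]) [set t : T1 | E j (along k j * s + across k j * t)].

Hypothesis nz : forall j, p j ^+ 2 + q j ^+ 2 != 0.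
Hypothesis det : forall i j, i != j -> across i j != 0.

Lemma measurable_slab S E : (forall j, measurable (E j)) -> measurable (slab S E).
Proof.
move=> mE; apply: fin_bigcap_measurable => // j _.
rewrite -[X in measurable X]setTI.
have := @measurable_form R 0 (p j) (q j).
rewrite (_ : (fun z => _) = lform j); first by move=> /(_ measurableT _ (mE j)).
by apply/funext => z; rewrite /lform add0r.
Qed.

Lemma measurable_fiber k J E s : (forall j, measurable (E j)) ->
  measurable (fiber k J E s).
Proof.
move=> mE; apply: fin_bigcap_measurable => // j _.
rewrite -[X in measurable X]setTI.
exact: (measurable_affine (along k j * s) (across k j) measurableT (mE j)).
Qed.

Lemma alongk k : along k k = 1.
Proof. by rewrite /along -!expr2 mulfV. Qed.

Lemma acrossk k : across k k = 0.
Proof. by rewrite /across mulrC subrr. Qed.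

(** The point [s v + t w] in the basis above: [s] is the value of [lform k], and [t] runs along the
    line on which it is constant. *)
Definition pt k (s t : R) : T1 * T1 :=
  (p k / (p k ^+ 2 + q k ^+ 2) * s - q k * t,
   q k / (p k ^+ 2 + q k ^+ 2) * s + p k * t).

Lemma lform_pt k j s t : lform j (pt k s t) = along k j * s + across k j * t.
Proof. rewrite /lform /pt /along /across /=; have := nz k => ?; by field. Qed.

Lemma slab_pt k S E s t : slab S E (pt k s t) <-> fiber k S E s t.
Proof. by split => H j jS; move: (H j jS); rewrite /= lform_pt. Qed.

Lemma mu2_pt k (D : set (T1 * T1)) : measurable D ->
  mu2 D = mu2 [set z | D (pt k z.1 z.2)].
Proof.
move=> mD; have := nz k => nzk.
have d1 : p k / (p k ^+ 2 + q k ^+ 2) * p k -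
    (- q k) * (q k / (p k ^+ 2 + q k ^+ 2)) = 1 by field.
have := @mu2_affine R 0 0 (p k / (p k ^+ 2 + q k ^+ 2)) (- q k)
  (q k / (p k ^+ 2 + q k ^+ 2)) (p k) D.
rewrite d1 oner_neq0 normr1 invr1 mul1e => /(_ isT mD) <-.
by congr (mu2 _); apply/seteqP; split => z /=; rewrite /pt !add0r mulNr.
Qed.

Lemma measurable_pt k (D : set (T1 * T1)) : measurable D ->
  measurable [set z | D (pt k z.1 z.2)].
Proof.
move=> mD; have := measurable_affine2 0 (p k / (p k ^+ 2 + q k ^+ 2)) (- q k) 0
  (q k / (p k ^+ 2 + q k ^+ 2)) (p k) mD.
by congr (measurable _); apply/seteqP; split => z /=; rewrite /pt !add0r mulNr.
Qed.

Lemma vol_fiber k S E : (forall j, measurable (E j)) ->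
  vol S E = (\int[mu]_s mu (fiber k S E s))%E.
Proof.
move=> mE; rewrite /vol (mu2_pt k) ?mu2_xE//; last exact: measurable_slab.
apply: eq_integral => s _; congr (mu _).
by apply/seteqP; split=> t /=; [move/slab_pt|move=> ?; exact/slab_pt].
Qed.

Lemma measurable_mu_fiber k S E : (forall j, measurable (E j)) ->
  measurable_fun setT (fun s => mu (fiber k S E s)).
Proof.
move=> mE; have := measurable_mu_x (measurable_pt k (measurable_slab S mE)).
apply: eq_measurable_fun => s _; congr (mu _).
by apply/seteqP; split=> t /=; [move/slab_pt|move=> ?; exact/slab_pt].
Qed.

(** Since [along k k = 1] and [across k k = 0], the condition of index [k] on a slice is [E k s],
    independent of [t]; it restricts the domain of integration. *)
Lemma vol_fiberD k S E : k \in S -> (forall j, measurable (E j)) ->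
  vol S E = (\int[mu]_(s in E k) mu (fiber k (S :\ k) E s))%E.
Proof.
move=> kS mE; rewrite (vol_fiber k)// [RHS]integral_mkcond.
apply: eq_integral => s _; rewrite patchE.
case: ifPn; rewrite ?inE ?notin_setE => Es.
  congr (mu _); apply/seteqP; split => t H j /=.
    by rewrite !inE => /andP[_ jS]; exact: H.
  move=> jS; have [->|jk] := eqVneq j k.
    by rewrite alongk acrossk mul0r addr0 mul1r.
  by apply: H; rewrite /= !inE jk.
suff -> : fiber k S E s = set0 by rewrite measure0.
apply/seteqP; split => // t /(_ k kS) /=.
by rewrite alongk acrossk mul0r addr0 mul1r.
Qed.

Lemma vol_sub S J E : J \subset S -> (forall j, measurable (E j)) ->
  (vol S E <= vol J E)%E.
Proof.
move=> /fintype.subsetP JS mE; apply: le_measure; rewrite ?inE.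
- exact: measurable_slab.
- exact: measurable_slab.
by move=> z H j jJ; apply: H; exact: JS.
Qed.

Definition trim k E (D U : I -> set T1) j : set T1 :=
  if j == k then E j else E j `\` (D j `|` U j).

Lemma measurable_trim k E (D U : I -> set T1) : (forall j, measurable (E j)) ->
  (forall j, measurable (D j)) -> (forall j, measurable (U j)) ->
  forall j, measurable (trim k E D U j).
Proof.
move=> mE mD mU j; rewrite /trim; case: eqP => // _; apply: measurableD => //.
exact: measurableU.
Qed.

(** In the coordinate [t], a tail of measure [T * |across k j|] has measure [T], so
    [measure_meet_trim] bounds the loss of each slice by [2 * T]; this is integrated over [E k]. *)
Lemma vol_trim k S E (D U : I -> set T1) (T : R) : k \in S ->
  (exists j, j \in S :\ k) -> (forall j, measurable (E j)) ->
  (forall j, measurable (D j)) -> (forall j, measurable (U j)) ->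
  (forall j, down_set (D j)) -> (forall j, up_set (U j)) ->
  0 <= T ->
  (forall j, j \in S :\ k -> mu (E j `&` D j) <= (T * `|across k j|)%:E)%E ->
  (forall j, j \in S :\ k -> mu (E j `&` U j) <= (T * `|across k j|)%:E)%E ->
  (vol S E <= (2 * T)%:E * mu (E k) + vol S (trim k E D U))%E.
Proof.
move=> kS J0 mE mD mU dD uU T0 ED EU.
have mE' := measurable_trim k mE mD mU.
have tk : trim k E D U k = E k by rewrite /trim eqxx.
rewrite (@vol_fiberD k S E)// (@vol_fiberD k S (trim k E D U))// tk.
rewrite -integral_cst// -ge0_integralD//; last first.
  by apply: measurable_funTS; exact: measurable_mu_fiber.
  by move=> s _; rewrite lee_fin mulr_ge0.
apply: ge0_le_integral => //=.
- by apply: measurable_funTS; exact: measurable_mu_fiber.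
- apply: emeasurable_funD; first exact: measurable_cst.
  by apply: measurable_funTS; exact: measurable_mu_fiber.
move=> s _.
pose aff (A : set T1) j := [set t : T1 | A (along k j * s + across k j * t)].
have maff A j : measurable A -> measurable (aff A j).
  move=> mA; rewrite -[X in measurable X]setTI.
  exact: (measurable_affine (along k j * s) (across k j) measurableT mA).
(* A negative coefficient reverses the line and turns left tails into right tails. *)
pose D' j := if 0 < across k j then aff (D j) j else aff (U j) j.
pose U' j := if 0 < across k j then aff (U j) j else aff (D j) j.
have maffT A j (T' : R) : j \in S :\ k -> measurable A ->
    (mu A <= (T' * `|across k j|)%:E -> mu (aff A j) <= T'%:E)%E.
  rewrite !inE => /andP[jk _] mA HA.
  have bj : across k j != 0 by rewrite det// eq_sym.
  rewrite /aff lebesgue_measure_affine//.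
  rewrite -lee_pdivlMl ?invr_gt0 ?normr_gt0// invrK -EFinM.
  by rewrite mulrC.
have : (mu (\bigcap_(j in [set` (S :\ k)%SET]) aff (E j) j) <= (2 * T)%:E +
   mu (\bigcap_(j in [set` (S :\ k)%SET]) (aff (E j) j `\` (D' j `|` U' j))))%E.
  apply: measure_meet_trim => // [j|j|j|j|j|j jJ|j jJ].
  - exact: maff.
  - by rewrite /D'; case: ifP => _; exact: maff.
  - by rewrite /U'; case: ifP => _; exact: maff.
  - rewrite /D'; case: ltP => b x y Hy xy.
      by apply: (dD j) Hy _; rewrite lerD2l ler_pM2l.
    by apply: (uU j) Hy _; rewrite lerD2l; exact: ler_wnM2l.
  - rewrite /U'; case: ltP => b x y Hy xy.
      by apply: (uU j) Hy _; rewrite lerD2l ler_pM2l.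
    by apply: (dD j) Hy _; rewrite lerD2l; exact: ler_wnM2l.
  - rewrite /D'; case: ifP => _.
      by apply: (maffT (E j `&` D j)); [|exact: measurableI|exact: ED].
    by apply: (maffT (E j `&` U j)); [|exact: measurableI|exact: EU].
  - rewrite /U'; case: ifP => _.
      by apply: (maffT (E j `&` U j)); [|exact: measurableI|exact: EU].
    by apply: (maffT (E j `&` D j)); [|exact: measurableI|exact: ED].
move=> /le_trans; apply; apply: leeD => //.
apply: le_measure; rewrite ?inE.
- apply: measurable_meet => j; apply: measurableD; first exact: maff.
  by apply: measurableU; rewrite /D' /U'; case: ifP => _; exact: maff.
- exact: measurable_fiber.
move=> t H j jJ; move: (H j jJ); rewrite /= /trim /D' /U' /aff /=.
move: jJ; rewrite /= !inE => /andP[/negbTE -> _].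
by case: ifP => _ [? /not_orP[? ?]]; split => // -[].
Qed.

End slabs.

(** * The rearrangement inequality for slabs *)

Section brascamp_lieb_luttinger.
Context {R : realType} {I : finType}.
Variables (p q : I -> R).
Local Notation mu := (@lebesgue_measure R).
Local Notation T1 := (measurableTypeR R).
Local Notation across := (across p q).
Local Notation along := (along p q).
Local Notation vol := (vol p q).
Local Notation fiber := (fiber p q).
Implicit Types (S J : {set I}) (E D U : I -> set T1) (i j k l : I) (h : I -> R).

Hypothesis nz : forall j, p j ^+ 2 + q j ^+ 2 != 0.
Hypothesis det : forall i j, i != j -> across i j != 0.

Definition sym h j : set T1 := `[- h j, h j]%classic.

Lemma measurable_sym h j : measurable (sym h j).
Proof. exact: measurable_itv. Qed.

(** On the line [lform k = s], the slab [|lform j| <= h j] cuts out, in the coordinate [t], the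
    interval with center [- slope k j * s] and radius [rad k h j]. *)
Definition slope k j : R := along k j / across k j.
Definition rad k h j : R := h j / `|across k j|.

Definition edge_gap k h i l : R :=
  rad k h i + rad k h l - `|slope k i - slope k l| * h k.

(** The half-width left when each end loses a tail that has measure [T] along the lines
    [lform k = s]. *)
Definition shrink k (T : R) h j : R := h j - T * `|across k j|.

Lemma itv_rad k h j s t : across k j != 0 ->
  (- h j <= along k j * s + across k j * t <= h j) =
  (- slope k j * s - rad k h j <= t <= - slope k j * s + rad k h j).
Proof.
move=> b0; have nb : 0 < `|across k j| by rewrite normr_gt0.
rewrite -!ler_norml.
have -> : (- slope k j * s - rad k h j <= t <= - slope k j * s + rad k h j) =
    (`|slope k j * s + t| <= rad k h j).
  rewrite ler_norml -lerBlDl lerBlDr.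
  by congr (_ && _); [rewrite -[RHS]lerBlDl|rewrite -[RHS]lerBrDl];
     congr (_ <= _); ring.
rewrite /rad ler_pdivlMr// -normrM; congr (`| _ | <= _).
by rewrite /slope; field.
Qed.

Lemma rad_shrink k T h j : across k j != 0 ->
  rad k (shrink k T h) j = rad k h j - T.
Proof.
by move=> b0; rewrite /rad /shrink mulrBl mulfK// normr_eq0.
Qed.

(** [lo] is the largest left end and [hi] the smallest right end of the intervals cut out by the
    slabs. Shrinking moves all these ends by the same [T], so the indices attaining [lo] and [hi] do
    not depend on [T]. *)
Lemma fiber_sym k J h s : (exists j, j \in J) ->
  (forall j, j \in J -> across k j != 0) ->
  exists lo hi, [/\ forall T, fiber k J (sym (shrink k T h)) s =
                              `[lo + T, hi - T]%classic,
    exists i l, [/\ i \in J, l \in J &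
      hi - lo = rad k h i + rad k h l - (slope k i - slope k l) * s] &
    forall i l, i \in J -> l \in J ->
      hi - lo <= rad k h i + rad k h l - (slope k i - slope k l) * s].
Proof.
move=> J0 b0.
have [l lJ lmax] := real_max (fun j => - slope k j * s - rad k h j) J0.
have [i iJ imin] := real_min (fun j => - slope k j * s + rad k h j) J0.
exists (- slope k l * s - rad k h l), (- slope k i * s + rad k h i); split.
- move=> T; apply/seteqP; split => t /=.
    move=> H; rewrite in_itv /=.
    have := H l lJ; have := H i iJ.
    rewrite /= /sym /= !in_itv /= !itv_rad ?b0// !rad_shrink ?b0//.
    by move=> /andP[_ H1] /andP[H2 _]; apply/andP; split; lra.
  rewrite in_itv /= => /andP[H1 H2] j jJ.
  rewrite /= /sym /= !in_itv /= itv_rad ?b0// rad_shrink ?b0//.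
  have := lmax j jJ; have := imin j jJ => H3 H4.
  by apply/andP; split; lra.
- by exists i, l; split => //; lra.
- by move=> a b aJ bJ; have := lmax b bJ; have := imin a aJ; lra.
Qed.

(* [edge_gap k h i l] bounds the length of the slices on the lines
   [lform k x = h k] and [lform k x = - h k], with equality for the best [i]
   and [l].  At depth [T] these two slices shrink to points, unless they are
   already empty, in which case [T = 0]: beyond them the slab of index [k] is
   redundant. *)
Definition critical_depth k J h (T : R) :=
  [/\ 0 <= T,
      T = 0 \/ (forall i l, i \in J -> l \in J -> 2 * T <= edge_gap k h i l) &
      exists i l, [/\ i \in J, l \in J & edge_gap k h i l <= 2 * T]].

Lemma critical_depth_exists k J h : (exists j, j \in J) ->
  exists T, critical_depth k J h T.
Proof.
move=> J0.
have [[i l]] : exists2 x : I * I, x \in finset.setX J J &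
    forall y, y \in finset.setX J J ->
    edge_gap k h x.1 x.2 <= edge_gap k h y.1 y.2.
  have [j jJ] := J0.
  by apply: (real_min (fun x : I * I => edge_gap k h x.1 x.2));
     exists (j, j); rewrite finset.in_setX jJ.
rewrite finset.in_setX /= => /andP[iJ lJ] H.
have [g0|g0] := leP 0 (edge_gap k h i l).
  exists (edge_gap k h i l / 2); split.
  - by rewrite divr_ge0.
  - right=> a b aJ bJ; rewrite mulrC divfK//.
    by apply: (H (a, b)); rewrite finset.in_setX aJ.
  - by exists i, l; split => //; rewrite mulrC divfK.
exists 0; split => //; first by left.
by exists i, l; split => //; rewrite mulr0 ltW.
Qed.

Lemma critical_depth_le k J h T j : critical_depth k J h T -> j \in J ->
  0 <= h j -> across k j != 0 -> T * `|across k j| <= h j.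
Proof.
move=> [T0 cT _] jJ hj bj; case: cT => [->|/(_ j j jJ jJ)]; first by rewrite mul0r.
rewrite /edge_gap subrr normr0 mul0r subr0 => H.
rewrite -ler_pdivlMr ?normr_gt0// -/(rad k h j); lra.
Qed.

Lemma mu_itv_cc (a b : R) : a <= b -> mu (`[a, b]%classic : set T1) = (b - a)%:E.
Proof.
move=> ab; rewrite lebesgue_measure_itv /= lte_fin lt_neqAle ab andbT.
by case: eqVneq => [->|_] //=; rewrite subrr.
Qed.

Lemma mu_itv_cc0 (a b : R) : b <= a -> mu (`[a, b]%classic : set T1) = 0%E.
Proof. by move=> ab; rewrite lebesgue_measure_itv /= lte_fin ltNge ab. Qed.

(** For [|s| <= h k] either [T = 0] or the slice is long enough to lose exactly [2 * T]; for larger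
    [|s|] the shrunken slice is null, which allows the integral to be extended to the whole line. *)
Lemma vol_sym_shrink k S h T : k \in S -> (exists j, j \in S :\ k) ->
  critical_depth k (S :\ k) h T ->
  vol S (sym h) = ((2 * T)%:E * mu (sym h k) +
                   vol (S :\ k) (sym (shrink k T h)))%E.
Proof.
move=> kS J0 [T0 cT [a [b [aJ bJ ab]]]].
have b0 j : j \in S :\ k -> across k j != 0.
  by rewrite !inE => /andP[jk _]; rewrite det// eq_sym.
have shrink0 : sym (shrink k 0 h) = sym h.
  by apply/funext => j; rewrite /sym /shrink mul0r subr0.
have mS := measurable_sym.
rewrite (@vol_fiberD _ _ p q nz k S)// (@vol_fiber _ _ p q nz k (S :\ k))//.
have -> : (\int[mu]_s mu (fiber k (S :\ k) (sym (shrink k T h)) s) =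
    \int[mu]_(s in sym h k) mu (fiber k (S :\ k) (sym (shrink k T h)) s))%E.
  rewrite [RHS]integral_mkcond; apply: eq_integral => s _.
  rewrite patchE; case: ifPn => //; rewrite notin_setE /sym /= in_itv /= -ler_norml.
  move=> /negP; rewrite -ltNge => hs.
  have [lo [hi [-> _ H]]] := fiber_sym h s J0 b0.
  apply: mu_itv_cc0; rewrite lerBlDr.
  (* The bound is taken for both orders of the pair because the sign of
     [(slope k a - slope k b) * s] is not known. *)
  have := H a b aJ bJ; have := H b a bJ aJ; rewrite /edge_gap in ab => H1 H2.
  have : `|slope k a - slope k b| * h k <= `|slope k a - slope k b| * `|s|.
    by rewrite ler_wpM2l// ltW.
  rewrite -normrM; case: (ger0P ((slope k a - slope k b) * s)) => _ ?; lra.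
rewrite -integral_cst// -ge0_integralD//; last 2 first.
- by move=> s _; rewrite lee_fin mulr_ge0.
- by apply: measurable_funTS; exact: measurable_mu_fiber.
apply: eq_integral => s; rewrite inE /sym /= in_itv /= -ler_norml => hs.
have [lo [hi [H [i [l [iJ lJ hilo]]] _]]] := fiber_sym h s J0 b0.
rewrite -/(sym h) -shrink0 !H.
case: cT => [->|/(_ i l iJ lJ) gapT].
  by rewrite mulr0 add0e.
have {}gapT : lo + T <= hi - T.
  suff : 2 * T <= hi - lo by lra.
  apply: le_trans gapT _; rewrite hilo /edge_gap lerD2l lerN2.
  apply: (le_trans (ler_norm _)); rewrite normrM.
  by rewrite ler_wpM2l.
by rewrite !mu_itv_cc//; [rewrite -EFinD; congr EFin; lra|lra].
Qed.

Definition half E j : R := mass (E j) / 2.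

Lemma mu_sym_half E j : finite_borel (E j) -> mu (sym (half E) j) = mu (E j).
Proof.
move=> fE; rewrite (massE fE) mu_itv_cc; last first.
  by rewrite /half; have := mass_ge0 (E j); lra.
by rewrite /half; congr EFin; lra.
Qed.

Definition trimming k J T E D U := forall j,
  [/\ measurable (D j), measurable (U j), down_set (D j), up_set (U j) &
   j \in J ->
   [/\ mass (E j `&` D j) = T * `|across k j|,
       mass (E j `&` U j) = T * `|across k j| &
       mass (E j `\` (D j `|` U j)) = mass (E j) - 2 * (T * `|across k j|)]].

Lemma trimming_exists k J T E : (forall j, finite_borel (E j)) -> 0 <= T ->
  (forall j, j \in J -> T * `|across k j| <= half E j) ->
  exists D U, trimming k J T E D U.
Proof.
move=> fE T0 TE.
have : forall j, exists X : set T1 * set T1,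
  [/\ measurable X.1, measurable X.2, down_set X.1, up_set X.2 & j \in J ->
   [/\ mass (E j `&` X.1) = T * `|across k j|,
       mass (E j `&` X.2) = T * `|across k j| &
       mass (E j `\` (X.1 `|` X.2)) = mass (E j) - 2 * (T * `|across k j|)]].
  move=> j; have [jJ|/negP nJ] := boolP (j \in J); last first.
    exists (set0, set0).
    by split => //; [exact: measurable0|exact: measurable0|move=> x y []..].
  have [||D [U [? ? ? ? ?]]] := @trim_exists R (E j) (T * `|across k j|) (fE j).
  - by rewrite mulr_ge0.
  - by have := TE j jJ; rewrite /half; lra.
  - by exists (D, U).
by case/choice => f fP; exists (fun j => (f j).1), (fun j => (f j).2).
Qed.

Lemma half_trim k J T E D U : trimming k J T E D U -> k \notin J ->
  forall j, j \in J -> half (trim k E D U) j = shrink k T (half E) j.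
Proof.
move=> tr kJ j jJ; have [_ _ _ _ /(_ jJ)[_ _ H]] := tr j.
rewrite /half /trim; have -> : (j == k) = false.
  by apply: contraNF kJ => /eqP <-.
rewrite H /shrink; lra.
Qed.

Lemma finite_borel_trim k J T E D U : trimming k J T E D U ->
  (forall j, finite_borel (E j)) -> forall j, finite_borel (trim k E D U j).
Proof.
move=> tr fE j; rewrite /trim; case: eqP => _; first exact: fE.
by have [? ? _ _ _] := tr j; apply: finite_borelD => //; exact: measurableU.
Qed.

Lemma trimming_vol k S T E D U : k \in S -> (exists j, j \in S :\ k) ->
  0 <= T -> (forall j, finite_borel (E j)) -> trimming k (S :\ k) T E D U ->
  (vol S E <= (2 * T)%:E * mu (E k) + vol S (trim k E D U))%E.
Proof.
move=> kS J0 T0 fE tr; apply: vol_trim => //.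
- by move=> j; case: (fE j).
- by move=> j; case: (tr j).
- by move=> j; case: (tr j).
- by move=> j; case: (tr j).
- by move=> j; case: (tr j).
- move=> j jJ; have [? ? _ _ /(_ jJ)[H _ _]] := tr j.
  by rewrite massE ?H//; exact: finite_borelI.
- move=> j jJ; have [? ? _ _ /(_ jJ)[_ H _]] := tr j.
  by rewrite massE ?H//; exact: finite_borelI.
Qed.

Lemma eq_vol S E E' : (forall j, j \in S -> E j = E' j) -> vol S E = vol S E'.
Proof.
move=> H; rewrite /vol; suff -> : slab p q S E = slab p q S E' by [].
by apply: eq_bigcapr => j jS; rewrite H.
Qed.

Theorem vol_le_sym S E : (exists j, j \in S) -> (forall j, finite_borel (E j)) ->
  (vol S E <= vol S (sym (half E)))%E.
Proof.
move: {2}#|S| (leqnn #|S|) E => m; elim: m S => [|m IH] S Sm E [k kS] fE.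
  by move: Sm; rewrite leqn0 cards_eq0 => /eqP S0; move: kS; rewrite S0 inE.
have mE j : measurable (E j) by case: (fE j).
have mS := measurable_sym.
(* If [k] is the only index, the slices are whole lines and both sides are the same product. *)
have [J0|/set0Pn J0] := eqVneq (S :\ k) finset.set0.
  rewrite (@vol_fiberD _ _ p q nz k S)// (@vol_fiberD _ _ p q nz k S (sym _))//.
  have fT E' s : fiber k (S :\ k) E' s = setT.
    by rewrite J0; apply/seteqP; split => // t _ j; rewrite /= inE.
  under eq_integral do rewrite fT.
  under [X in (_ <= X)%E]eq_integral do rewrite fT.
  by rewrite !integral_cst// [X in (_ <= _ * X)%E]mu_sym_half.
have [T cT] := critical_depth_exists k (half E) J0.
have T0 : 0 <= T by case: cT.
have b0 j : j \in S :\ k -> across k j != 0.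
  by rewrite !inE => /andP[jk _]; rewrite det// eq_sym.
have h0 j : 0 <= half E j by rewrite /half divr_ge0// mass_ge0.
have [D [U tr]] := @trimming_exists k (S :\ k) T E fE T0
  (fun j jJ => critical_depth_le cT jJ (h0 j) (b0 j jJ)).
apply: (le_trans (trimming_vol kS J0 T0 fE tr)).
rewrite (vol_sym_shrink kS J0 cT) mu_sym_half// leeD2l//.
have fE' := finite_borel_trim tr fE.
apply: (@le_trans _ _ (vol (S :\ k) (trim k E D U))).
  by apply: vol_sub => // [|j]; [exact: subsetDl|case: (fE' j)].
have <- : vol (S :\ k) (sym (half (trim k E D U))) =
    vol (S :\ k) (sym (shrink k T (half E))).
  by apply: eq_vol => j jJ; rewrite /sym (half_trim tr)// !inE eqxx.
have Sk : (#|(S :\ k)%SET| <= m)%N by move: Sm; rewrite (cardsD1 k S) kS.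
exact: (IH _ Sk _ J0 fE').
Qed.

End brascamp_lieb_luttinger.

(** * Essential sumsets on the line and their equality case *)

Lemma integral0_null d (T : measurableType d) (R : realType)
    (m : {measure set T -> \bar R}) (D : set T) (f : T -> \bar R) :
  measurable D -> measurable_fun D f -> (forall x, D x -> 0 <= f x)%E ->
  (\int[m]_(x in D) f x = 0)%E -> m (D `&` [set x | f x != 0%E]) = 0%E.
Proof.
move=> mD mf f0 If.
have /(ae_eq_integral_abs _ mD mf)[N [mN N0 subN]] :
    (\int[m]_(x in D) `|f x| = 0)%E.
  by rewrite -If; apply: eq_integral => x; rewrite inE => /f0 /gee0_abs.
apply: (subset_measure0 _ mN) => //; first exact: emeasurable_neq.
by move=> x [Dx /eqP fx]; apply: subN => /(_ Dx).
Qed.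

Section essential_sumset.
Context {R : realType}.
Local Notation mu := (@lebesgue_measure R).
Local Notation mu2 := (@lebesgue_measure R \x @lebesgue_measure R)%E.
Local Notation T1 := (measurableTypeR R).
Implicit Types A B C : set T1.

Definition ctr_itv (c h : R) : set T1 := `[c - h, c + h]%classic.

Definition aeq A B := mu (A `\` B) = 0%E /\ mu (B `\` A) = 0%E.

(* The exceptional set of the relation "[A + B] is essentially contained in
   [C]". *)
Definition sum_escape A B C : set (T1 * T1) :=
  [set z | [/\ A z.1, B z.2 & ~ C (z.1 + z.2)]].

Lemma measurable_sum_escape A B C : measurable A -> measurable B ->
  measurable C -> measurable (sum_escape A B C).
Proof.
move=> mA mB mC.
have mS : measurable [set z : T1 * T1 | C (z.1 + z.2)].
  rewrite -[X in measurable X]setTI.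
  have := @measurable_form R 0 1 1 measurableT C mC.
  congr (measurable _); apply/seteqP.
  by split=> z /=; rewrite !mul1r add0r.
have -> : sum_escape A B C = (A `*` B) `\` [set z : T1 * T1 | C (z.1 + z.2)].
  by apply/seteqP; split=> z; [case=> ? ? ?|case=> -[]].
by apply: measurableD => //; exact: measurableX.
Qed.

Lemma sum_escapeC A B C : measurable A -> measurable B -> measurable C ->
  mu2 (sum_escape B A C) = mu2 (sum_escape A B C).
Proof.
move=> mA mB mC; rewrite -mu2_swap; last exact: measurable_sum_escape.
by congr (mu2 _); apply/seteqP; split=> z [] /=; rewrite addrC.
Qed.

Lemma null_mass A : measurable A -> mu A = 0%E -> finite_borel A /\ mass A = 0.
Proof. by move=> mA A0; split; [split=> //; rewrite A0 ltry|rewrite /mass A0]. Qed.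

Lemma mass_le_ae A B : finite_borel A -> finite_borel B ->
  mu (A `\` B) = 0%E -> mass A <= mass B.
Proof.
move=> fA fB AB; have [mA _] := fA; have [mB _] := fB.
rewrite (massDI fA mB) {1}/mass AB /= add0r; apply: massS => //.
exact: measurableI.
Qed.

Lemma translate_measurable A x : measurable A -> measurable [set y : T1 | A (x + y)].
Proof.
move=> mA; rewrite -[X in measurable X]setTI.
have := @measurable_affine R x 1 measurableT A mA.
by congr (measurable _); apply/seteqP; split=> z /=; rewrite mul1r.
Qed.

Lemma mu_translate A x : measurable A -> mu [set y : T1 | A (x + y)] = mu A.
Proof.
move=> mA; rewrite -[RHS]mul1e.
have := @lebesgue_measure_affine R x 1 A (oner_neq0 _) mA.
rewrite normr1 invr1 => <-.
by congr (mu _); apply/seteqP; split=> z /=; rewrite mul1r.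
Qed.

Lemma mass_le_translate A B x : finite_borel A -> finite_borel B ->
  mu [set y : T1 | A y /\ ~ B (x + y)] = 0%E -> mass A <= mass B.
Proof.
move=> fA fB AB; have [mB Bfin] := fB.
have -> : mass B = mass [set y : T1 | B (x + y)] by rewrite /mass mu_translate.
apply: mass_le_ae => //; split; first exact: translate_measurable.
by rewrite mu_translate.
Qed.

(** By Tonelli, almost every section of the null set [sum_escape A B C] is null, so a part of [A] of
    positive measure contains a point whose section is null. *)
Lemma good_point A B C (P : set T1) : finite_borel A -> measurable B ->
  measurable C -> measurable P -> mu2 (sum_escape A B C) = 0%E ->
  0 < mass (A `&` P) ->
  exists x, [/\ A x, P x & mu [set y : T1 | B y /\ ~ C (x + y)] = 0%E].
Proof.
move=> fA mB mC mP N0 AP; have [mA _] := fA.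
have mN := measurable_sum_escape mA mB mC.
move: N0; rewrite mu2_xE => /(integral0_null measurableT (measurable_mu_x mN)).
rewrite setTI => /(_ (fun _ _ => measure_ge0 _ _)) N0.
have mbad := emeasurable_neq measurableT (measurable_mu_x mN) 0%E.
rewrite setTI in mbad.
apply: contrapT => H.
suff : mass (A `&` P) <= mass [set x | mu [set y | sum_escape A B C (x, y)] != 0%E].
  by rewrite {2}/mass N0 /= leNgt AP.
apply: massS; first exact: measurableI.
  by apply: (null_mass _ N0).1.
move=> x [Ax Px] /=; apply/eqP => Nx; apply: H; exists x; split=> //.
rewrite -[RHS]Nx; congr (mu _); apply/seteqP; split=> y /=; first by case.
by case.
Qed.

(* Up to mass [e], [C] contains the disjoint pieces [x + B] and [A + y], for [x]
   near the left end of [A] and [y] near the right end of [B]. *)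
Lemma mass_sum_le A B C : finite_borel A -> finite_borel B -> finite_borel C ->
  0 < mass A -> 0 < mass B -> mu2 (sum_escape A B C) = 0%E ->
  mass A + mass B <= mass C.
Proof.
move=> fA fB fC A0 B0 N0.
have [mA _] := fA; have [mB _] := fB; have [mC _] := fC.
apply/ler_addgt0Pr => e e0.
(* The bound [e / 2] makes the total loss [2 * t] at most [e]; the other two keep the quantile
   levels [t] and [mass B - t] strictly inside their ranges. *)
pose t := Num.min (e / 2) (Num.min (mass A / 2) (mass B / 2)).
have t0 : 0 < t by rewrite !lt_min !divr_gt0.
have te : t <= e / 2 by rewrite ge_min lexx.
have tA : t <= mass A / 2 by rewrite !ge_min lexx !orbT.
have tB : t <= mass B / 2 by rewrite !ge_min lexx !orbT.
have [a aE] : exists x, left_mass A x = t.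
  by apply: left_mass_ivt => //; apply/andP; split; lra.
have [b bE] : exists x, left_mass B x = mass B - t.
  by apply: left_mass_ivt => //; apply/andP; split; lra.
have [x [Ax xa xg]] := @good_point A B C `]-oo, a[%classic fA mB mC
  (measurable_itv _) N0 (eq_ind_r (fun u => 0 < u) t0 aE).
have [y [By yb yg]] : exists y, [/\ B y, `[b, +oo[%classic y &
    mu [set x : T1 | A x /\ ~ C (y + x)] = 0%E].
  apply: (good_point fB mA mC (measurable_itv _)); first by rewrite sum_escapeC.
  by rewrite right_massE// bE; lra.
rewrite /= in_itv /= in xa; rewrite /= in_itv /= andbT in yb.
have H1 : mass B - t <= left_mass C (x + y).
  rewrite -bE; apply: (le_trans (left_mass_nd fB yb)).
  apply: (@mass_le_translate _ _ x).
  - by apply: finite_borelI => //; exact: measurable_itv.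
  - by apply: finite_borelI => //; exact: measurable_itv.
  have mB' : measurable [set y : T1 | B y /\ ~ C (x + y)].
    exact: (measurableD mB (translate_measurable x mC)).
  apply: (subset_measure0 _ mB') => //.
    apply: measurableD; last apply: translate_measurable.
      by apply: measurableI => //; exact: measurable_itv.
    by apply: measurableI => //; exact: measurable_itv.
  move=> z [[Bz zy] Cz]; split=> // Cxz; apply: Cz; split => //.
  by move: zy; rewrite /= !in_itv /= ltrD2l.
have H2 : mass A - t <= mass C - left_mass C (x + y).
  have : left_mass A x <= t by rewrite -aE; apply: left_mass_nd => //; exact: ltW.
  move=> Hx; apply: (@le_trans _ _ (mass A - left_mass A x)); first by lra.
  rewrite -!right_massE//.
  apply: (@mass_le_translate _ _ y).
  - by apply: finite_borelI => //; exact: measurable_itv.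
  - by apply: finite_borelI => //; exact: measurable_itv.
  have mA' : measurable [set x : T1 | A x /\ ~ C (y + x)].
    exact: (measurableD mA (translate_measurable y mC)).
  apply: (subset_measure0 _ mA') => //.
    apply: measurableD; last apply: translate_measurable.
      by apply: measurableI => //; exact: measurable_itv.
    by apply: measurableI => //; exact: measurable_itv.
  move=> z [[Az zx] Cz]; split=> // Cyz; apply: Cz; split => //.
  by move: zx; rewrite /= !in_itv /= !andbT [x + y]addrC lerD2l.
lra.
Qed.

(* [mass_sum_le] applied to the left parts and to the right parts of [A] and [B]
   gives two inequalities that add up to an equality. *)
Lemma left_mass_sum A B C x y : finite_borel A -> finite_borel B ->
  finite_borel C -> mu2 (sum_escape A B C) = 0%E ->
  mass C <= mass A + mass B ->
  0 < left_mass A x < mass A -> 0 < left_mass B y < mass B ->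
  left_mass C (x + y) = left_mass A x + left_mass B y.
Proof.
move=> fA fB fC N0 CAB /andP[xA Ax] /andP[yB By].
have [mA _] := fA; have [mB _] := fB; have [mC _] := fC.
have fI D (i : interval R) : finite_borel D -> finite_borel (D `&` [set` i]).
  by move=> fD; apply: finite_borelI => //; exact: measurable_itv.
have esc A' B' C' : finite_borel A' -> finite_borel B' -> finite_borel C' ->
    sum_escape A' B' C' `<=` sum_escape A B C -> mu2 (sum_escape A' B' C') = 0%E.
  move=> [mA' _] [mB' _] [mC' _] sub.
  by apply: subset_measure0 sub _ => //; exact: measurable_sum_escape.
have L : left_mass A x + left_mass B y <= left_mass C (x + y).
  apply: mass_sum_le => //; try exact: fI.
  apply: esc; try exact: fI.
  move=> -[u v] [/= [Au ux] [Bv vy] Cuv]; split=> //= Cuv'; apply: Cuv; split=> //.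
  by move: ux vy; rewrite /= !in_itv /= => ux vy; exact: ltrD.
have G : mass (A `&` `[x, +oo[) + mass (B `&` `[y, +oo[) <=
    mass (C `&` `[x + y, +oo[).
  apply: mass_sum_le; try exact: fI.
  - by rewrite right_massE// subr_gt0.
  - by rewrite right_massE// subr_gt0.
  apply: esc; try exact: fI.
  move=> -[u v] [/= [Au ux] [Bv vy] Cuv]; split=> //= Cuv'; apply: Cuv; split=> //.
  by move: ux vy; rewrite /= !in_itv /= !andbT => ux vy; exact: lerD.
by move: G; rewrite !right_massE// => G; apply/eqP; rewrite eq_le L andbT; lra.
Qed.

(** The point is chosen by Lebesgue density between the quantiles of levels 1/3 and 2/3, away from
    both ends of the range of [left_mass A]. *)
Lemma density_point A e : finite_borel A -> 0 < mass A -> 0 < e ->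
  exists x r0, 0 < r0 /\ forall r, 0 < r < r0 ->
    [/\ (1 - e) * (2 * r) <= left_mass A (x + r) - left_mass A (x - r),
        0 < left_mass A (x - r) < mass A & 0 < left_mass A (x + r) < mass A].
Proof.
move=> fA m0 e0; have [mA _] := fA.
have [a aE] : exists x, left_mass A x = mass A / 3.
  by apply: left_mass_ivt => //; apply/andP; split; lra.
have [b bE] : exists x, left_mass A x = 2 * mass A / 3.
  by apply: left_mass_ivt => //; apply/andP; split; lra.
have ab : a <= b.
  by rewrite leNgt; apply/negP => /ltW /(left_mass_nd fA); lra.
have mid : mass (A `&` `[a, b[) = mass A / 3.
  by have := left_mass_split fA ab; lra.
have [N [mN N0 subN]] := lebesgue_density mA.
have [x [Ax xab xN]] : exists x, [/\ A x, a <= x < b & ~ N x].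
  apply: contrapT => H; suff : mass (A `&` `[a, b[) <= mass N.
    by rewrite {2}/mass N0 /= mid; lra.
  apply: massS; last 1 first.
  - move=> x [Ax]; rewrite /= in_itv /= => xab; apply: contrapT => xN.
    by apply: H; exists x.
  - by apply: measurableI => //; exact: measurable_itv.
  - exact: (null_mass mN N0).1.
have : (mu (A `&` ball x r) * (mu (ball x r))^-1)%E @[r --> 0^'+] --> (\1_A x)%:E.
  by apply: contrapT => /subN.
rewrite indicE mem_set//=; have {xab} /andP[ax xb] := xab.
move=> /fine_cvgP[_] /cvgrPdist_le /(_ e e0) [d /= d0 dH].
(* As [left_mass A] is 1-Lipschitz and 1/4 < 1/3, a radius below [mass A / 4] keeps its values at
   [x - r] and [x + r] strictly between 0 and [mass A]. *)
exists x, (Num.min d (mass A / 4)); split.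
  by rewrite lt_min d0 /= divr_gt0.
move=> r /andP[r0]; rewrite lt_min => /andP[rd rm].
have Fax := left_mass_nd fA ax; have Fxb := left_mass_nd fA (ltW xb).
have xr1 : x - r <= x by lra.
have xr2 : x <= x + r by lra.
have := left_mass_lip fA xr1; have := left_mass_lip fA xr2.
have := left_mass_nd fA xr1; have := left_mass_nd fA xr2 => n1 n2 l1 l2.
split; last 2 first.
- by apply/andP; split; lra.
- by apply/andP; split; lra.
have xrr : x - r <= x + r by lra.
rewrite (left_mass_split fA xrr) addrAC subrr add0r.
have := dH r; rewrite /= sub0r normrN gtr0_norm// => /(_ rd r0).
rewrite lebesgue_measure_ball; last exact: ltW.
have -> : r *+ 2 = 2 * r by rewrite mulr_natl.
have fb : finite_borel (A `&` ball x r).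
  by apply: finite_borelI => //; exact: measurable_ball.
rewrite (massE fb) inver mulf_eq0 pnatr_eq0 /= (gt_eqF r0) -EFinM /=.
have Ab : mass (A `&` ball x r) <= mass (A `&` `[x - r, x + r[).
  apply: massS; first by case: fb.
    by apply: finite_borelI => //; exact: measurable_itv.
  rewrite ball_itv => z [Az]; rewrite /= !in_itv /= => /andP[z1 z2].
  by split => //; rewrite z2 ltW.
move=> H; apply: le_trans Ab; rewrite -ler_pdivlMr; last by rewrite mulr_gt0.
by move: H; rewrite ler_norml => /andP[_]; lra.
Qed.

(* By [left_mass_sum] the increments of [left_mass A] and [left_mass B] over
   intervals of equal length agree, so a density point of [A] forces the slope
   of [left_mass B] everywhere. *)
Lemma left_mass_unit_slope A B C y y' : finite_borel A -> finite_borel B ->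
  finite_borel C -> mu2 (sum_escape A B C) = 0%E -> 0 < mass A ->
  mass C <= mass A + mass B -> y <= y' ->
  0 < left_mass B y < mass B -> 0 < left_mass B y' < mass B ->
  left_mass B y' - left_mass B y = y' - y.
Proof.
move=> fA fB fC N0 A0 CAB; rewrite le_eqVlt => /orP[/eqP ->|yy' By By'].
  by rewrite !subrr.
apply/eqP; rewrite eq_le left_mass_lip ?(ltW yy')//=.
suff H e : 0 < e -> (1 - e) * (y' - y) <= left_mass B y' - left_mass B y.
  apply/ler_addgt0Pr => e e0.
  have d0 : 0 < e / (y' - y) by rewrite divr_gt0 ?subr_gt0.
  by have := H _ d0; rewrite mulrBl mul1r divfK ?subr_eq0 ?gt_eqF// lerBlDr.
move=> e0; have [x [r0 [r00 xr]]] := density_point fA A0 e0.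
(* The interval from [y] to [y'] is cut into [n] steps of length [2 * r], with [n] large enough for
   [r < r0]. *)
pose n := (Num.truncn ((y' - y) / r0)).+1.
pose r := (y' - y) / (2 * n%:R).
have n0 : (0 : R) < n%:R by rewrite ltr0n.
have rpos : 0 < r by rewrite divr_gt0 ?subr_gt0// mulr_gt0.
have rr0 : r < r0.
  rewrite /r ltr_pdivrMr ?mulr_gt0// -ltr_pdivrMl// mulrC.
  by have := truncnS_gt ((y' - y) / r0); rewrite -/n; lra.
have rr : 0 < 2 * r by rewrite mulr_gt0.
have [slope Ax1 Ax2] := xr r (introT andP (conj rpos rr0)).
have y'E : y' = y + 2 * r * n%:R by rewrite /r; field; rewrite gt_eqF.
have inB k : (k <= n)%N -> 0 < left_mass B (y + 2 * r * k%:R) < mass B.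
  move=> kn; have /andP[By0 _] := By; have /andP[_ By1] := By'.
  apply/andP; split.
    apply: lt_le_trans By0 _; apply: left_mass_nd => //.
    by rewrite lerDl mulr_ge0// ltW.
  apply: le_lt_trans By1; apply: left_mass_nd => //.
  by rewrite y'E lerD2l ler_wpM2l ?ler_nat// ltW.
suff main k : (k <= n)%N -> k%:R * ((1 - e) * (2 * r)) <=
    left_mass B (y + 2 * r * k%:R) - left_mass B y.
  have := main n (leqnn n); rewrite -y'E; apply: le_trans.
  by rewrite le_eqVlt; apply/orP; left; apply/eqP; rewrite y'E; ring.
elim: k => [|k IH] kn; first by rewrite mulr0 addr0 subrr mul0r.
have := IH (ltnW kn).
have c1 := left_mass_sum fA fB fC N0 CAB Ax1 (inB _ kn).
have c2 := left_mass_sum fA fB fC N0 CAB Ax2 (inB _ (ltnW kn)).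
(* Both decompositions name the same point of the line of [C]. Hence the increment of [left_mass B]
   over this step equals that of [left_mass A] over the interval from [x - r] to [x + r]. *)
have : x - r + (y + 2 * r * k.+1%:R) = x + r + (y + 2 * r * k%:R).
  by rewrite -natr1; ring.
by move=> E; move: c1; rewrite E c2 -natr1 mulrDl mul1r; lra.
Qed.

(** The center is a median of [B]. Unit slope puts the quantiles of levels [mass B / 2 - u] and
    [mass B / 2 + u] at distance [u] from it, so [B] fills the interval between them; [u] then tends
    to [mass B / 2]. *)
Lemma sumset_interval A B C : finite_borel A -> finite_borel B ->
  finite_borel C -> mu2 (sum_escape A B C) = 0%E -> 0 < mass A -> 0 < mass B ->
  mass C <= mass A + mass B -> exists c, aeq B (ctr_itv c (mass B / 2)).
Proof.
move=> fA fB fC N0 A0 B0 CAB; have [mB _] := fB.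
have [c cE] : exists x, left_mass B x = mass B / 2.
  by apply: left_mass_ivt => //; apply/andP; split; lra.
exists c.
have fc : finite_borel (ctr_itv c (mass B / 2)).
  split; first exact: measurable_itv.
  by rewrite /ctr_itv lebesgue_measure_itv /=; case: ifP => _; rewrite -?EFinB ltry.
have mc : mass (ctr_itv c (mass B / 2)) = mass B.
  rewrite /ctr_itv (@mass_itv _ _ (c - mass B / 2) (c + mass B / 2) true false)//.
    lra.
  by lra.
have BI : mass (B `&` ctr_itv c (mass B / 2)) = mass B.
  apply/eqP; rewrite eq_le; apply/andP; split.
    by apply: massS => //; case: (finite_borelI fB fc.1).
  apply/ler_addgt0Pr => e e0.
  (* [u] stays below [mass B / 2], where quantiles exist; the value 0 occurs only for [mass B <= e],
     when the claim is immediate. *)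
  pose u := Num.max 0 (mass B / 2 - e / 2).
  have u0 : 0 <= u by rewrite le_max lexx.
  have uB : u < mass B / 2 by rewrite gt_max; apply/andP; split; lra.
  have ue : mass B / 2 - e / 2 <= u by rewrite le_max lexx orbT.
  have [y yE] : exists x, left_mass B x = mass B / 2 - u.
    by apply: left_mass_ivt => //; apply/andP; split; lra.
  have [y' y'E] : exists x, left_mass B x = mass B / 2 + u.
    by apply: left_mass_ivt => //; apply/andP; split; lra.
  have [yy' | y'y] := leP y y'; last first.
    have := left_mass_nd fB (ltW y'y); rewrite yE y'E => ?.
    by have := mass_ge0 (B `&` ctr_itv c (mass B / 2)); lra.
  have slope z z' := @left_mass_unit_slope A B C z z' fA fB fC N0 A0 CAB.
  have yc : y <= c \/ u = 0.
    have [|cy] := leP y c; first by left.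
    by right; have := left_mass_nd fB (ltW cy); lra.
  have cy' : c <= y' \/ u = 0.
    have [|cy] := leP c y'; first by left.
    by right; have := left_mass_nd fB (ltW cy); lra.
  case: yc => [yc|u00]; last first.
    by have := mass_ge0 (B `&` ctr_itv c (mass B / 2)); lra.
  case: cy' => [cy'|u00]; last first.
    by have := mass_ge0 (B `&` ctr_itv c (mass B / 2)); lra.
  have := slope _ _ yc; rewrite yE cE => s1.
  have := slope _ _ cy'; rewrite y'E cE => s2.
  have := left_mass_split fB yy'; rewrite yE y'E => s3.
  have s4 : mass (B `&` `[y, y'[) <= mass (B `&` ctr_itv c (mass B / 2)).
    apply: massS.
    - by apply: measurableI => //; exact: measurable_itv.
    - by apply: finite_borelI => //; exact: measurable_itv.
    move=> z [Bz]; rewrite /= /ctr_itv !in_itv /= => /andP[z1 z2]; split => //=.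
    have {}s1 : mass B / 2 - (mass B / 2 - u) = c - y.
      by apply: s1; apply/andP; split; lra.
    have {}s2 : mass B / 2 + u - mass B / 2 = y' - c.
      by apply: s2; apply/andP; split; lra.
    by rewrite in_itv /=; apply/andP; split; lra.
  lra.
have [fD1 fD2] := (finite_borelD fB fc.1, finite_borelD fc mB).
split; rewrite (massE fD1, massE fD2); congr EFin.
  by have := massDI fB fc.1; rewrite BI; lra.
by have := massDI fc mB; rewrite setIC BI mc; lra.
Qed.

End essential_sumset.

(** * Polygons with a nonempty side on every line, and their shrinking *)

Section admissible_half_widths.
Context {R : realType} {I : finType}.
Variables (p q : I -> R).
Local Notation T1 := (measurableTypeR R).
Local Notation across := (across p q).
Local Notation along := (along p q).
Local Notation lform := (lform p q).
Local Notation pt := (pt p q).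
Local Notation slope := (slope p q).
Local Notation rad := (rad p q).
Local Notation shrink := (shrink p q).
Local Notation edge_gap := (edge_gap p q).
Local Notation critical_depth := (critical_depth p q).
Implicit Types (S J : {set I}) (i j k l : I) (h : I -> R) (x z : T1 * T1).

Hypothesis nz : forall j, p j ^+ 2 + q j ^+ 2 != 0.
Hypothesis det : forall i j, i != j -> across i j != 0.

Lemma across_neq0 k S j : j \in S :\ k -> across k j != 0.
Proof. by rewrite !inE => /andP[jk _]; rewrite det// eq_sym. Qed.

Lemma pt_surj k z : exists t, z = pt k (lform k z) t.
Proof.
exists ((p k * z.2 - q k * z.1) / (p k ^+ 2 + q k ^+ 2)).
have := nz k => nzk; case: z => a b; rewrite /pt /lform /=.
by congr pair; field.
Qed.

(** The inequalities are not strict, so the side may be a single vertex; the opposite side is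
    covered by the symmetry [x -> - x]. *)
Definition edge_nonempty S h k :=
  exists x, lform k x = h k /\ forall j, j \in S -> `|lform j x| <= h j.

(* The slabs [|lform j x| <= h j], [j \in S], form a polygon each of whose
   sides [lform k x = h k] is nonempty. *)
Definition adm S h := forall k, k \in S -> 0 < h k /\ edge_nonempty S h k.

Lemma norm_lform_pt k h j s t : across k j != 0 ->
  (`|lform j (pt k s t)| <= h j) =
  (- slope k j * s - rad k h j <= t <= - slope k j * s + rad k h j).
Proof. by move=> b0; rewrite lform_pt// ler_norml itv_rad. Qed.

Lemma edge_gap_slice k h i l s T : 2 * T <= edge_gap k h i l -> `|s| <= h k ->
  2 * T <= rad k h i + rad k h l - (slope k i - slope k l) * s.
Proof.
move=> /le_trans H sh; apply: H; rewrite /edge_gap lerD2l lerN2.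
by apply: (le_trans (ler_norm _)); rewrite normrM ler_wpM2l.
Qed.

(** A point on the side lies in the slice of every slab on [lform k = h k], so no right end there
    precedes a left end. *)
Lemma edge_gap_ge0 S h k i l : 0 <= h k -> edge_nonempty S h k ->
  i \in S :\ k -> l \in S :\ k -> 0 <= edge_gap k h i l.
Proof.
move=> h0 [x [xk xS]] iS lS.
have bi := across_neq0 iS; have bl := across_neq0 lS.
move: iS lS; rewrite !inE => /andP[_ iS] /andP[_ lS].
have [t xE] := pt_surj k x; have := xS i iS; have := xS l lS.
rewrite xE xk !norm_lform_pt// => /andP[l1 l2] /andP[i1 i2].
rewrite /edge_gap -{1}(ger0_norm h0) -normrM.
case: (ger0P ((slope k i - slope k l) * h k)) => _; lra.
Qed.

(** A critical depth [T = 0] allows negative gaps; here the lower bound on the gaps is required for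
    [T = 0] as well, which admissibility provides. *)
Definition full_depth k J h T := [/\ 0 <= T,
  forall i l, i \in J -> l \in J -> 2 * T <= edge_gap k h i l &
  critical_depth k J h T].

Lemma full_depthP S h k T : adm S h -> k \in S ->
  critical_depth k (S :\ k) h T -> full_depth k (S :\ k) h T.
Proof.
move=> aS kS cT; have [T0 [T00|gap] _] := cT; split => // i l iS lS.
  have [h0 ek] := aS k kS; rewrite T00 mulr0.
  exact: edge_gap_ge0 (ltW h0) ek iS lS.
Qed.

(** All slices with [|s| <= h k] have length at least [2 * T], so shrinking leaves each of them a
    point, for instance [lo + T]. *)
Lemma shrink_slice k J h T s : (exists j, j \in J) ->
  (forall j, j \in J -> across k j != 0) -> full_depth k J h T -> `|s| <= h k ->
  exists t, forall j, j \in J -> `|lform j (pt k s t)| <= shrink k T h j.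
Proof.
move=> J0 b0 [T0 gap _] sh.
have [lo [hi [H [i [l [iJ lJ hilo]]] _]]] := fiber_sym h s J0 b0.
exists (lo + T) => j jJ.
suff : fiber p q k J (sym (shrink k T h)) s (lo + T).
  by move=> /(_ j jJ); rewrite /sym /= in_itv /= lform_pt// ler_norml.
rewrite H /= in_itv /= lexx /=.
by have := edge_gap_slice (gap i l iJ lJ) sh; rewrite -hilo; lra.
Qed.

(* [x'] is [x] moved by [T] along the direction that [lform k] annihilates,
   towards the inside of the slab of index [i]. *)
Lemma shrink_edge k J h T i x : (forall j, j \in J -> across k j != 0) ->
  full_depth k J h T -> i \in J -> lform i x = h i -> `|lform k x| <= h k ->
  (forall j, j \in J -> `|lform j x| <= h j) ->
  exists x' e, [/\ e = 1 \/ e = -1, lform i x' = shrink k T h i,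
    forall j, j \in J -> `|lform j x'| <= shrink k T h j &
    forall j, lform j x' = lform j x - e * T * across k j].
Proof.
move=> b0 [T0 gap _] iJ xi xk xJ; have bi := b0 i iJ.
have [t xE] := pt_surj k x; set s := lform k x in xk xE.
have hT j : j \in J -> (`|lform j x| <= h j) =
    (- slope k j * s - rad k h j <= t <= - slope k j * s + rad k h j).
  by move=> jJ; rewrite xE norm_lform_pt// b0.
pose e : R := Num.sg (across k i).
have ei : e * across k i = `|across k i| by rewrite /e -normrEsg.
have eE : e = 1 \/ e = -1.
  by rewrite /e; case: sgrP bi => //= _ _; [left|right].
have fx' j : lform j (pt k s (t - e * T)) = lform j x - e * T * across k j.
  by rewrite [in RHS]xE !lform_pt// /along; ring.
exists (pt k s (t - e * T)), e; split => //.
  by rewrite fx' xi /shrink mulrAC ei mulrC.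
move=> j jJ; rewrite norm_lform_pt ?b0// !rad_shrink ?b0//.
have := xJ j jJ; rewrite hT// => /andP[j1 j2].
(* As [lform i x = h i], [t] is an end of the interval of the slab [i]; every opposite end is at
   least [2 * T] away, so a move by [T] stays clear of it. *)
have tE : t = - slope k i * s + e * rad k h i.
  have : along k i * s + across k i * t = h i by rewrite -xi xE lform_pt.
  move=> ht; apply: (mulfI bi); rewrite mulrDr.
  have -> : across k i * (e * rad k h i) = h i.
    by rewrite mulrA [_ * e]mulrC ei /rad mulrCA mulfV ?mulr1// normr_eq0.
  by rewrite -ht /slope; field.
have := edge_gap_slice (gap i j iJ jJ) xk; have := edge_gap_slice (gap j i jJ iJ) xk.
case: eE tE => -> tE g1 g2; apply/andP; split; lra.
Qed.

(** A point on the side of index [i] is carried by [shrink_edge] to a point on the corresponding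
    side of the shrunken polygon. *)
Lemma adm_shrink S h k T : adm S h -> k \in S -> full_depth k (S :\ k) h T ->
  (forall j, j \in S :\ k -> 0 < shrink k T h j) ->
  adm (S :\ k) (shrink k T h).
Proof.
move=> aS kS fT pos i iJ; split; first exact: pos.
have [iS ik] : i \in S /\ i != k by move: iJ; rewrite !inE => /andP[].
have [_ [x [xi xS]]] := aS i iS.
have [||x' [e [_ x'i x'J _]]] :=
  @shrink_edge k (S :\ k) h T i x _ fT iJ xi (xS k kS).
- by move=> j; exact: across_neq0.
- by move=> j; rewrite !inE => /andP[_ jS]; exact: xS.
by exists x'.
Qed.

(** Because [Ti > 0], the side of index [i] has a point [x] strictly inside the slab [j]. If the
    shrunken slab [j] had width 0, the moved point [x'] would satisfy [lform j x' = 0], and undoing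
    the move would give [|lform j x| = T * |across k j| = h j]. *)
Lemma shrink_gt0 S h k T i Ti j : adm S h -> k \in S ->
  full_depth k (S :\ k) h T -> i \in S :\ k -> j \in S :\ k -> i != j ->
  full_depth i (S :\ i) h Ti -> 0 < Ti -> 0 < shrink k T h j.
Proof.
move=> aS kS fT iJ jJ ij fTi Ti0.
have [iS ik] : i \in S /\ i != k by move: iJ; rewrite !inE => /andP[].
have [jS jk] : j \in S /\ j != k by move: jJ; rewrite !inE => /andP[].
have bij := det ij.
have jSi : j \in S :\ i by rewrite !inE eq_sym ij.
have hi0 := (aS i iS).1; have hj0 := (aS j jS).1.
have [|||t xS] := @shrink_slice i (S :\ i) h Ti (h i) _ _ fTi.
- by exists j.
- by move=> l; exact: across_neq0.
- by rewrite gtr0_norm.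
set x := pt i (h i) t in xS.
have xi : lform i x = h i.
  by rewrite /x lform_pt// alongk// acrossk mul0r addr0 mul1r.
have xj : `|lform j x| < h j.
  apply: le_lt_trans (xS j jSi) _.
  by rewrite /shrink gtrBl mulr_gt0// normr_gt0.
have xS' l : l \in S -> `|lform l x| <= h l.
  move=> lS; have [->|li] := eqVneq l i; first by rewrite xi gtr0_norm.
  have lSi : l \in S :\ i by rewrite !inE li.
  apply: le_trans (xS l lSi) _; rewrite /shrink gerBl.
  by rewrite mulr_ge0// ltW.
have [||x' [e [eE _ x'J x'E]]] :=
  @shrink_edge k (S :\ k) h T i x _ fT iJ xi (xS' k kS).
- by move=> l; exact: across_neq0.
- by move=> l; rewrite !inE => /andP[_ lS]; exact: xS'.
have T0 : 0 <= T by case: fT.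
have sh0 : 0 <= shrink k T h j by apply: le_trans (x'J j jJ).
rewrite lt_neqAle sh0 andbT; apply/eqP => sh.
have := x'J j jJ; rewrite -sh normr_le0 => /eqP; rewrite x'E => /eqP.
rewrite subr_eq0 => /eqP xjE; move: xj; rewrite xjE.
have -> : `|e * T * across k j| = T * `|across k j|.
  rewrite !normrM (ger0_norm T0).
  by case: eE => ->; rewrite ?normrN normr1 mul1r.
by move: sh; rewrite /shrink; lra.
Qed.

End admissible_half_widths.

(** * Equality of sets up to null sets *)

Lemma negligible_exists_in d (T : measurableType d) (R : realType) (I : eqType)
    (m : {measure set T -> \bar R}) (s : seq I) (F : I -> set T) :
  (forall i, i \in s -> m.-negligible (F i)) ->
  m.-negligible [set z | exists2 i, i \in s & F i z].
Proof.
elim: s => [|i s IH] H.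
  by apply: negligibleS (negligible_set0 _) => z [].
apply: (@negligibleS _ _ _ _ (F i `|` [set z | exists2 i, i \in s & F i z])).
  move=> z [j]; rewrite inE => /orP[/eqP ->|js] Fz; first by left.
  by right; exists j.
apply: negligibleU; first by apply: H; rewrite mem_head.
by apply: IH => j js; apply: H; rewrite inE js orbT.
Qed.

Section almost_everywhere_equality.
Context {R : realType}.
Local Notation mu := (@lebesgue_measure R).
Local Notation T1 := (measurableTypeR R).
Implicit Types A B C : set T1.

Lemma aeq_refl A : aeq A A.
Proof. by split; rewrite setDv measure0. Qed.

Lemma aeq_sym A B : aeq A B -> aeq B A.
Proof. by case. Qed.

Lemma null_setD_trans A B C : measurable A -> measurable B -> measurable C ->
  mu (A `\` B) = 0%E -> mu (B `\` C) = 0%E -> mu (A `\` C) = 0%E.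
Proof.
move=> mA mB mC AB BC.
have mAB : measurable (A `\` B) by exact: measurableD.
have mBC : measurable (B `\` C) by exact: measurableD.
have mAC : measurable (A `\` C) by exact: measurableD.
apply/negligibleP => //; apply: (@negligibleS _ _ _ _ ((A `\` B) `|` (B `\` C))).
  by move=> x [Ax Cx]; have [Bx|Bx] := pselect (B x); [right|left].
by apply: negligibleU; exact/negligibleP.
Qed.

Lemma aeq_trans A B C : measurable A -> measurable B -> measurable C ->
  aeq A B -> aeq B C -> aeq A C.
Proof.
move=> mA mB mC [AB BA] [BC CB].
by split; [apply: (@null_setD_trans _ B)|apply: (@null_setD_trans _ B)].
Qed.

Lemma aeq_mass A B : finite_borel A -> finite_borel B -> aeq A B ->
  mass A = mass B.
Proof.
move=> fA fB [AB BA].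
by apply/eqP; rewrite eq_le; apply/andP; split; exact: mass_le_ae.
Qed.

Lemma finite_borel_itv (a b : R) (x y : bool) :
  finite_borel ([set` Interval (BSide x a) (BSide y b)] : set T1).
Proof.
split; first exact: measurable_itv.
by rewrite lebesgue_measure_itv /=; case: ifP => _; rewrite ?ltry// -EFinB ltry.
Qed.

Lemma finite_borel_ctr (c h : R) : finite_borel (ctr_itv c h).
Proof. exact: finite_borel_itv. Qed.

Lemma mass_ctr (c h : R) : 0 <= h -> mass (ctr_itv c h) = 2 * h.
Proof.
move=> h0; rewrite /ctr_itv (@mass_itv _ _ (c - h) (c + h) true false)//; lra.
Qed.

Lemma ctr_itv_inj (c c' h : R) : 0 < h -> aeq (ctr_itv c h) (ctr_itv c' h) ->
  c = c'.
Proof.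
suff H (a b : R) : 0 < h -> mu (ctr_itv a h `\` ctr_itv b h) = 0%E -> b <= a.
  by move=> h0 [H1 H2]; apply/eqP; rewrite eq_le !H.
move=> h0 H; rewrite leNgt; apply/negP => ab.
(* For [a < b], the part of the first interval to the left of [m] has positive length and misses the
   second interval. *)
pose m := Num.min (b - h) (a + h).
have am : a - h < m by rewrite lt_min; apply/andP; split; lra.
have := @massS R `[a - h, m[%classic (ctr_itv a h `\` ctr_itv b h).
rewrite {2}/mass H (@mass_itv _ _ (a - h) m true true) ?(ltW am)//.
move=> /(_ (measurable_itv _)).
apply: contraTnot (am); rewrite -leNgt => /(_ _ _) W; rewrite -subr_le0; apply: W.
  by apply: finite_borelD; [exact: finite_borel_ctr|exact: measurable_itv].
move=> z; rewrite /= /ctr_itv /= !in_itv /= lt_min => /andP[z1 /andP[z2 z3]].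
by split; [rewrite z1 ltW|apply/negP; rewrite negb_and -ltNge z2].
Qed.

Lemma ctr_itv_unique A (c h : R) : finite_borel A -> mass A = 2 * h -> 0 <= h ->
  mu (ctr_itv c h `\` A) = 0%E -> aeq A (ctr_itv c h).
Proof.
move=> fA Ah h0 H; split => //.
have fc := finite_borel_ctr c h; have [mA _] := fA; have [mc _] := fc.
have E1 := massDI fA mc; have E2 := massDI fc mA.
rewrite (massE (finite_borelD fA mc)); congr EFin.
by move: E2; rewrite {2}/mass H /= mass_ctr// setIC; lra.
Qed.

End almost_everywhere_equality.

(** * Volumes up to null sets, and equality after trimming *)

Lemma ereal_squeeze (R : realDomainType) (a : R) (x y z w : \bar R) :
  (x <= a%:E + y -> y <= z -> z <= w -> x = a%:E + w -> y = z /\ z = w)%E.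
Proof.
move=> xy yz zw xE; have wy : (w <= y)%E by move: xy; rewrite xE leeD2lE.
by split; apply/eqP; rewrite eq_le ?yz ?zw /=;
  [exact: le_trans wy|exact: le_trans yz].
Qed.

Section volume_of_slabs.
Context {R : realType} {I : finType}.
Variables (p q : I -> R).
Local Notation mu := (@lebesgue_measure R).
Local Notation mu2 := (@lebesgue_measure R \x @lebesgue_measure R)%E.
Local Notation T1 := (measurableTypeR R).
Local Notation across := (across p q).
Local Notation along := (along p q).
Local Notation vol := (vol p q).
Local Notation fiber := (fiber p q).
Local Notation lform := (lform p q).
Implicit Types (S J : {set I}) (E D U : I -> set T1) (i j k l : I) (h : I -> R).

Hypothesis nz : forall j, p j ^+ 2 + q j ^+ 2 != 0.
Hypothesis det : forall i j, i != j -> across i j != 0.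

Lemma measurable_preim j (A : set T1) : measurable A ->
  measurable (lform j @^-1` A).
Proof.
move=> mA; have := measurable_slab p q [set j]%SET (fun _ : I => mA).
congr (measurable _); apply/seteqP; split=> z.
  by move=> /(_ j); apply; rewrite /= inE.
by move=> Az i /=; rewrite inE => /eqP ->.
Qed.

Lemma null_preim j (N : set T1) : measurable N -> mu N = 0%E ->
  mu2 (lform j @^-1` N) = 0%E.
Proof.
move=> mN N0.
have -> : mu2 (lform j @^-1` N) = vol [set j]%SET (fun _ => N).
  congr (product_measure1 _ _ _); apply/seteqP; split=> z.
    by move=> Az i /=; rewrite inE => /eqP ->.
  by move=> /(_ j); apply; rewrite /= inE.
rewrite (@vol_fiberD _ _ p q nz j) ?inE//.
rewrite (ge0_negligible_integral mN mN _ _ N0) ?setDv ?integral_set0//.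
by apply: measurable_funTS; exact: measurable_mu_fiber.
Qed.

Lemma slab_null S E E' : (forall j, measurable (E j)) ->
  (forall j, measurable (E' j)) ->
  (forall j, j \in S -> mu (E j `\` E' j) = 0%E) ->
  mu2 (slab p q S E `\` slab p q S E') = 0%E.
Proof.
move=> mE mE' EE'.
have mS := measurable_slab p q S mE; have mS' := measurable_slab p q S mE'.
apply/negligibleP; first exact: measurableD.
apply: (@negligibleS _ _ _ _ [set z | exists2 j, j \in enum S &
   (lform j @^-1` (E j `\` E' j)) z]).
  move=> z [zE /existsNP[j /not_implyP[jS zj]]]; exists j.
    by rewrite mem_enum.
  by split=> //; exact: zE.
apply: negligible_exists_in => j; rewrite mem_enum => jS.
apply/negligibleP; first by apply: measurable_preim; exact: measurableD.
by apply: null_preim; [exact: measurableD|exact: EE'].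
Qed.

Lemma vol_le_ae S E E' : (forall j, measurable (E j)) ->
  (forall j, measurable (E' j)) ->
  (forall j, j \in S -> mu (E j `\` E' j) = 0%E) -> (vol S E <= vol S E')%E.
Proof.
move=> mE mE' EE'; have N0 := slab_null mE mE' EE'.
have mS := measurable_slab p q S mE; have mS' := measurable_slab p q S mE'.
rewrite /vol -[leRHS]adde0 -N0.
apply: (le_trans _ (measureU2 _ _ _)) => //; last exact: measurableD.
apply: le_measure; rewrite ?inE//.
  by apply: measurableU => //; exact: measurableD.
by move=> z zE; have [?|?] := pselect (slab p q S E' z); [left|right].
Qed.

Lemma vol_aeq S E E' : (forall j, measurable (E j)) ->
  (forall j, measurable (E' j)) ->
  (forall j, j \in S -> aeq (E j) (E' j)) -> vol S E = vol S E'.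
Proof.
move=> mE mE' EE'; apply/eqP; rewrite eq_le; apply/andP; split;
  by apply: vol_le_ae => // j /EE' [].
Qed.

(** Two slabs in independent directions suffice: every slice over [E i] has measure at most
    [|E j| / |across i j|]. *)
Lemma vol_fin S E i j : i \in S -> j \in S -> i != j ->
  (forall j, finite_borel (E j)) -> (vol S E < +oo)%E.
Proof.
move=> iS jS ij fE; have mE l : measurable (E l) by case: (fE l).
rewrite (@vol_fiberD _ _ p q nz i)//.
apply: (@le_lt_trans _ _
    (\int[mu]_(s in E i) (cst (`|across i j|^-1%:E * mu (E j))) s)%E).
  apply: ge0_le_integral => //.
    by apply: measurable_funTS; exact: measurable_mu_fiber.
  move=> s _ /=.
  rewrite -(lebesgue_measure_affine (along i j * s) (det ij) (mE j)).
  apply: le_measure; rewrite ?inE; first exact: measurable_fiber.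
    rewrite -[X in measurable X]setTI.
    exact: (measurable_affine _ _ measurableT (mE j)).
  by move=> t; apply; rewrite /= !inE eq_sym ij.
rewrite integral_cst// (massE (fE j)) -[X in (_ * X < _)%E]/(mu (E i)).
by rewrite (massE (fE i)) -!EFinM ltry.
Qed.

(** Equality closes up the chain of inequalities in [vol_le_sym]; the term [2 T |E k|] is finite and
    cancels. The first conclusion says that [E k] is redundant for the trimmed sets, the second that
    these are again a case of equality. *)
Lemma trimming_equality k S T E D U : k \in S -> (exists j, j \in S :\ k) ->
  (forall j, finite_borel (E j)) ->
  critical_depth p q k (S :\ k) (half E) T ->
  trimming p q k (S :\ k) T E D U ->
  vol S E = vol S (sym (half E)) ->
  let E' := trim k E D U in
  vol S E' = vol (S :\ k) E' /\ vol (S :\ k) E' = vol (S :\ k) (sym (half E')).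
Proof.
move=> kS J0 fE cT tr eqE E'.
have T0 : 0 <= T by case: cT.
have fE' := finite_borel_trim tr fE; rewrite -/E' in fE'.
have l1 := trimming_vol nz det kS J0 T0 fE tr.
have l2 : (vol S E' <= vol (S :\ k) E')%E.
  by apply: vol_sub => // [|j]; [exact: subsetDl|case: (fE' j)].
have l3 := vol_le_sym nz det J0 fE'.
have e4 : vol (S :\ k) (sym (half E')) =
    vol (S :\ k) (sym (shrink p q k T (half E))).
  by apply: eq_vol => j jJ; rewrite /sym (half_trim tr)// !inE eqxx.
have e5 := vol_sym_shrink nz det kS J0 cT.
rewrite -e4 (mu_sym_half (fE k)) (massE (fE k)) -EFinM in e5.
rewrite (massE (fE k)) -EFinM in l1.
exact: ereal_squeeze l1 l2 l3 (etrans eqE e5).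
Qed.

End volume_of_slabs.

(** * Recognizing intervals when one slab is redundant *)

Section equality_cases.
Context {R : realType} {I : finType}.
Variables (p q : I -> R).
Local Notation mu := (@lebesgue_measure R).
Local Notation mu2 := (@lebesgue_measure R \x @lebesgue_measure R)%E.
Local Notation T1 := (measurableTypeR R).
Local Notation across := (across p q).
Local Notation along := (along p q).
Local Notation vol := (vol p q).
Local Notation fiber := (fiber p q).
Local Notation lform := (lform p q).
Local Notation shrink := (shrink p q).
Local Notation adm := (adm p q).
Implicit Types (S J : {set I}) (E D U : I -> set T1) (i j k l : I) (h : I -> R).

Hypothesis nz : forall j, p j ^+ 2 + q j ^+ 2 != 0.
Hypothesis det : forall i j, i != j -> across i j != 0.

Lemma ctr_itvP (c r s : R) : ctr_itv c r s <-> `|s - c| <= r.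
Proof. by rewrite /ctr_itv /= in_itv /= ler_distl. Qed.

(** The polygon contains the segment from [z] to [z + x], its mirror image, and a neighborhood of
    [z]. Hence its slices with [|s - lform k z| < h k] have positive length, and redundancy forces
    almost all such [s] into [E k], whose mass leaves no room for more. *)
Lemma boundary_interval k S E h (z x : T1 * T1) : k \in S ->
  (exists j, j \in S :\ k) -> (forall j, finite_borel (E j)) ->
  (forall j, j \in S :\ k -> 0 < h j) -> 0 <= h k -> mass (E k) = 2 * h k ->
  (forall j, j \in S :\ k -> aeq (E j) (ctr_itv (lform j z) (h j))) ->
  lform k x = h k -> (forall j, j \in S :\ k -> `|lform j x| <= h j) ->
  vol S E = vol (S :\ k) E -> (vol (S :\ k) E < +oo)%E ->
  aeq (E k) (ctr_itv (lform k z) (h k)).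
Proof.
move=> kS J0 fE h0 hk mk Ez xk xJ eqv vfin.
apply: ctr_itv_unique => //.
pose C j := if j == k then E k else ctr_itv (lform j z) (h j).
have fC j : finite_borel (C j).
  by rewrite /C; case: eqP => // _; exact: finite_borel_ctr.
have mC j : measurable (C j) by case: (fC j).
have mE j : measurable (E j) by case: (fE j).
have EC j : j \in S -> aeq (E j) (C j).
  move=> jS; rewrite /C; case: eqVneq => [->|jk]; first exact: aeq_refl.
  by apply: Ez; rewrite !inE jk.
have EJ j : j \in S :\ k -> aeq (E j) (C j).
  by rewrite !inE => /andP[_]; exact: EC.
have Ck : C k = E k by rewrite /C eqxx.
move: eqv vfin; rewrite (@vol_aeq _ _ p q nz S E C)//.
rewrite (@vol_aeq _ _ p q nz (S :\ k) E C)//.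
rewrite (@vol_fiberD _ _ p q nz k S)// (@vol_fiber _ _ p q nz k (S :\ k))// Ck.
pose f : T1 -> \bar R := fun s => mu (fiber k (S :\ k) C s).
have mf : measurable_fun setT f by exact: measurable_mu_fiber.
move=> eqI; rewrite -/f => Ifin; rewrite -[LHS]/(\int[mu]_(s in E k) f s)%E in eqI.
rewrite -[RHS]/(\int[mu]_s f s)%E in eqI.
have mEk := mE k; have mEkC : measurable (~` E k) by exact: measurableC.
(* The two volumes are equal and finite, so the slices over the complement of [E k] contribute
   nothing. *)
have If0 : (\int[mu]_(s in ~` E k) f s = 0)%E.
  have := @ge0_integral_setU _ _ _ mu _ _ mEk mEkC f.
  rewrite setUv => /(_ mf (fun _ _ => measure_ge0 _ _)).
  have dis : [disjoint E k & ~` E k] by apply/disj_setPS; rewrite setICr.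
  move=> /(_ dis) H; move: H Ifin; rewrite -eqI.
  have I1 : (0 <= \int[mu]_(s in E k) f s)%E by apply: integral_ge0.
  have I2 : (0 <= \int[mu]_(s in ~` E k) f s)%E by apply: integral_ge0.
  move: I1 I2; case: (\int[mu]_(s in E k) f s)%E => //= a _.
  case: (\int[mu]_(s in ~` E k) f s)%E => //= b _ -[ab] _.
  by congr EFin; lra.
have N0 := integral0_null mEkC (measurable_funTS mf)
  (fun _ _ => measure_ge0 _ _) If0.
have mN : measurable (~` E k `&` [set s | f s != 0%E]).
  by apply: emeasurable_neq => //; exact: measurable_funTS.
apply/negligibleP; first by apply: measurableD => //; exact: measurable_itv.
(* The two end values of [s], whose slices may be single points, are set apart as a null set. *)
apply: (@negligibleS _ _ _ _ ((~` E k `&` [set s | f s != 0%E]) `|`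
    ([set lform k z - h k] `|` [set lform k z + h k]))); last first.
  apply: negligibleU; first exact/negligibleP.
  by apply: negligibleU; apply/negligibleP;
    [exact: measurable_set1|exact: lebesgue_measure_set1|
     exact: measurable_set1|exact: lebesgue_measure_set1].
move=> s [/ctr_itvP szh Es].
have [sz|] := ltP `|s - lform k z| (h k); last first.
  move=> hs; right; have : `|s - lform k z| = h k by apply/eqP; rewrite eq_le szh.
  by case: (ger0P (s - lform k z)) => _ H; [right|left]; rewrite /=; lra.
left; split=> //=; rewrite gt_eqF//.
have hk0 : 0 < h k by apply: le_lt_trans sz.
have [t0 zE] := pt_surj nz k z; have [tx xE] := pt_surj nz k x.
(* [z + th * x] is the point of the segment at which [lform k] takes the value [s]. *)
pose th := (s - lform k z) / h k.
have sE : s = lform k z + th * h k by rewrite /th divfK ?gt_eqF// addrC subrK.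
have th1 : `|th| < 1.
  by rewrite normrM normfV (gtr0_norm hk0) ltr_pdivrMr// mul1r.
have b0 j : j \in S :\ k -> 0 < `|across k j|.
  by move=> jJ; rewrite normr_gt0; exact: across_neq0 jJ.
have [i iJ rmin] := real_min (rad p q k h) J0.
have ri0 : 0 < rad p q k h i by rewrite /rad divr_gt0 ?h0 ?b0.
(* At [z + th * x] the slab [j] still has room [(1 - |th|) * h j], which along the line is
   [(1 - |th|)] times its radius; [i] has the smallest radius. *)
pose d := (1 - `|th|) * rad p q k h i.
have d0 : 0 < d by rewrite mulr_gt0 ?subr_gt0.
apply: (@lt_le_trans _ _ (mu (ctr_itv (t0 + th * tx) d : set T1))).
  rewrite (massE (finite_borel_ctr _ _)) lte_fin mass_ctr; last exact: ltW.
  by rewrite mulr_gt0.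
apply: le_measure; rewrite ?inE.
- by case: (finite_borel_ctr (t0 + th * tx) d).
- exact: measurable_fiber.
move=> t /ctr_itvP td j /= jJ.
have jk : (j == k) = false by move: jJ; rewrite !inE => /andP[/negbTE].
rewrite /C jk; apply/ctr_itvP.
have -> : along k j * s + across k j * t - lform j z =
    th * lform j x + across k j * (t - (t0 + th * tx)).
  rewrite {1}zE {1}xE !lform_pt// xk sE; ring.
apply: (le_trans (ler_normD _ _)); rewrite (normrM th) (normrM (across k j)).
have e1 : `|th| * `|lform j x| <= `|th| * h j by rewrite ler_wpM2l ?xJ.
have e2 : `|across k j| * `|t - (t0 + th * tx)| <= `|across k j| * d.
  by rewrite ler_wpM2l.
have e3 : `|across k j| * d <= (1 - `|th|) * h j.
  rewrite /d mulrCA; apply: ler_wpM2l; first by rewrite subr_ge0 ltW.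
  by have := rmin j jJ; rewrite {2}/rad ler_pdivlMr ?b0// mulrC.
apply: (le_trans (lerD e1 (le_trans e2 e3))).
by rewrite -mulrDl addrC subrK mul1r.
Qed.

Lemma measurable_scale (A : set T1) (a : R) : measurable A ->
  measurable [set u : T1 | A (a * u)].
Proof.
move=> mA; rewrite -[X in measurable X]setTI.
have := @measurable_affine R 0 a measurableT A mA.
by congr (measurable _); apply/seteqP; split=> z /=; rewrite add0r.
Qed.

Lemma mu_scale (A : set T1) (a : R) : a != 0 -> measurable A ->
  mu [set u : T1 | A (a * u)] = (`|a|^-1%:E * mu A)%E.
Proof.
move=> a0 mA; rewrite -(lebesgue_measure_affine 0 a0 mA).
by congr (mu _); apply/seteqP; split=> z /=; rewrite add0r.
Qed.

Lemma finite_borel_scale (A : set T1) (a : R) : a != 0 -> finite_borel A ->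
  finite_borel [set u : T1 | A (a * u)] /\
  mass [set u : T1 | A (a * u)] = `|a|^-1 * mass A.
Proof.
move=> a0 fA; have [mA _] := fA.
have E : mu [set u : T1 | A (a * u)] = (`|a|^-1 * mass A)%:E.
  by rewrite mu_scale// (massE fA) EFinM.
by split; [split; [exact: measurable_scale|rewrite E ltry]|rewrite /mass E].
Qed.

Lemma aeq_unscale (A : set T1) (a c : R) : a != 0 -> measurable A ->
  let B := [set u : T1 | A (a^-1 * u)] in
  aeq B (ctr_itv c (mass B / 2)) -> finite_borel A ->
  aeq A (ctr_itv (c / a) (mass A / 2)).
Proof.
move=> a0 mA B [H1 H2] fA.
have na : 0 < `|a| by rewrite normr_gt0.
have ai0 : a^-1 != 0 by rewrite invr_eq0.
have [fB mB] := finite_borel_scale ai0 fA.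
have mBm : measurable B by case: fB.
have mc c' r : measurable (ctr_itv c' r : set T1) by exact: measurable_itv.
have AB s : B (a * s) <-> A s by rewrite /B /= mulKf.
have ctrE s : ctr_itv c (mass B / 2) (a * s) <-> ctr_itv (c / a) (mass A / 2) s.
  rewrite -/B in mB; rewrite !ctr_itvP mB normfV invrK.
  have -> : a * s - c = a * (s - c / a) by field.
  by rewrite normrM -mulrA ler_pM2l.
have S1 : mu [set s : T1 | (B `\` ctr_itv c (mass B / 2)) (a * s)] = 0%E.
  by rewrite mu_scale ?H1 ?mule0//; exact: measurableD.
have S2 : mu [set s : T1 | (ctr_itv c (mass B / 2) `\` B) (a * s)] = 0%E.
  by rewrite mu_scale ?H2 ?mule0//; exact: measurableD.
split; [rewrite -[RHS]S1|rewrite -[RHS]S2]; congr (mu _);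
  by apply/seteqP; split=> s; rewrite /setD /=; move: (AB s) (ctrE s); tauto.
Qed.

(** [lform k] is a combination of [lform i] and [lform j], so redundancy of [E k] says that the
    essential sumset of the dilates [A] and [B] of [E i] and [E j] lies in [E k]. *)
Lemma pair_intervals k S E i j (x : T1 * T1) : k \in S ->
  i \in S :\ k -> j \in S :\ k -> i != j ->
  (forall l, l \in S :\ k -> l = i \/ l = j) ->
  (forall j, finite_borel (E j)) -> 0 < mass (E i) -> 0 < mass (E j) ->
  lform k x = half E k -> (forall j, j \in S :\ k -> `|lform j x| <= half E j) ->
  vol S E = vol (S :\ k) E ->
  exists z, forall l, l \in S :\ k -> aeq (E l) (ctr_itv (lform l z) (half E l)).
Proof.
move=> kS iJ jJ ij Jij fE mi mj xk xJ eqv.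
have mE l : measurable (E l) by case: (fE l).
have [dij ik jk] : [/\ across i j != 0, across i k != 0 & across k j != 0].
  split; [exact: det| |exact: across_neq0 jJ].
  by apply: det; move: iJ; rewrite !inE => /andP[].
(* Cramer's rule for [lform k] in the basis [lform i], [lform j]. *)
pose a := across k j / across i j; pose b := across i k / across i j.
have a0 : a != 0 by rewrite mulf_neq0 ?invr_eq0.
have b0 : b != 0 by rewrite mulf_neq0 ?invr_eq0.
have kE z : lform k z = a * lform i z + b * lform j z.
  by rewrite /a /b /across /lform; move: dij; rewrite /across => dij; field.
pose A := [set u : T1 | E i (a^-1 * u)]; pose B := [set u : T1 | E j (b^-1 * u)].
have [ai bi] : a^-1 != 0 /\ b^-1 != 0 by rewrite !invr_eq0.
have [fA mA] := finite_borel_scale ai (fE i).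
have [fB mB] := finite_borel_scale bi (fE j).
have mAm : measurable A by case: fA.
have mBm : measurable B by case: fB.
rewrite -/A normfV invrK in mA; rewrite -/B normfV invrK in mB.
have A0 : 0 < mass A by rewrite mA mulr_gt0// normr_gt0.
have B0 : 0 < mass B by rewrite mB mulr_gt0// normr_gt0.
(* The required bound on [mass (E k)] comes from [x]: [half E k = lform k x] is at most
   [|a| * half E i + |b| * half E j]. *)
have CAB : mass (E k) <= mass A + mass B.
  have : `|lform k x| <= `|a| * half E i + `|b| * half E j.
    rewrite kE; apply: (le_trans (ler_normD _ _)); rewrite !normrM.
    by apply: lerD; apply: ler_wpM2l => //; exact: xJ.
  have := ler_norm (lform k x); rewrite mA mB xk /half; lra.
have vfin := vol_fin nz det iJ jJ ij fE.
have N0 : mu2 (sum_escape A B (E k)) = 0%E.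
  have detN : (a * p i) * (b * q j) - (a * q i) * (b * p j) != 0.
    have -> : (a * p i) * (b * q j) - (a * q i) * (b * p j) = a * b * across i j.
      by rewrite /across; ring.
    by apply: mulf_neq0 => //; exact: mulf_neq0.
  have mN := measurable_sum_escape mAm mBm (mE k).
  have := mu2_affine 0 0 detN mN.
  set W := [set z | _].
  (* In the coordinates [(a * lform i, b * lform j)] the exceptional set of the sumset is what the
     slab [k] removes from the other two, a null set by equality of the finite volumes. *)
  have -> : W = slab p q (S :\ k) E `\` slab p q S E.
    have WE z : W z <-> [/\ E i (lform i z), E j (lform j z) & ~ E k (lform k z)].
      rewrite /W /sum_escape /A /B /= !add0r.
      have -> : a * p i * z.1 + a * q i * z.2 = a * lform i z.
        by rewrite /lform; ring.
      have -> : b * p j * z.1 + b * q j * z.2 = b * lform j z.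
        by rewrite /lform; ring.
      by rewrite -kE !mulKf.
    apply/seteqP; split=> z.
      move=> /WE[Ei Ej Ek]; split; last by move=> /(_ k kS).
      by move=> l /= /Jij [] ->.
    move=> [zJ zS]; apply/WE; split; [exact: zJ|exact: zJ|move=> Ek; apply: zS].
    move=> l /= lS; have [->//|lk] := eqVneq l k.
    by apply: zJ; rewrite /= !inE lk.
  have mS := measurable_slab p q S mE; have mJ := measurable_slab p q (S :\ k) mE.
  have SJ : slab p q S E `<=` slab p q (S :\ k) E.
    by move=> z zS l /=; rewrite !inE => /andP[_]; exact: zS.
  rewrite measureD// setIidr// -[X in (X - _)%E]/(vol (S :\ k) E).
  rewrite -[X in (_ - X)%E]/(vol S E) eqv.
  have vpos : (0 <= vol (S :\ k) E)%E by apply: measure_ge0.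
  rewrite subee ?ge0_fin_numE// => /esym/eqP.
  by rewrite mule_eq0 eqe invr_eq0 normr_eq0 (negbTE detN) /= => /eqP.
have [mj' Bj] := sumset_interval fA fB (fE k) N0 A0 B0 CAB.
have N0' : mu2 (sum_escape B A (E k)) = 0%E by rewrite sum_escapeC.
have CBA : mass (E k) <= mass B + mass A by rewrite addrC.
have [mi' Ai] := sumset_interval fB fA (fE k) N0' B0 A0 CBA.
have {}Ai := aeq_unscale a0 (mE i) Ai (fE i).
have {}Bj := aeq_unscale b0 (mE j) Bj (fE j).
set ci := mi' / a in Ai; set cj := mj' / b in Bj.
(* Cramer's rule again: the point with [lform i z = ci] and [lform j z = cj]. *)
pose z : T1 * T1 := ((ci * q j - cj * q i) / across i j,
                     (p i * cj - p j * ci) / across i j).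
have zi : lform i z = ci.
  by rewrite /lform /z /=; move: dij; rewrite /across => dij; field.
have zj : lform j z = cj.
  by rewrite /lform /z /=; move: dij; rewrite /across => dij; field.
by exists z => l /Jij [] ->; rewrite ?zi ?zj.
Qed.

End equality_cases.

(** * The induction for the case of equality *)

Section equality_theorem.
Context {R : realType} {I : finType}.
Variables (p q : I -> R).
Local Notation mu := (@lebesgue_measure R).
Local Notation T1 := (measurableTypeR R).
Local Notation across := (across p q).
Local Notation vol := (vol p q).
Local Notation lform := (lform p q).
Local Notation shrink := (shrink p q).
Local Notation adm := (adm p q).
Local Notation full_depth := (full_depth p q).
Local Notation trimming := (trimming p q).
Implicit Types (S J : {set I}) (E D U : I -> set T1) (i j k l : I) (h : I -> R).

Hypothesis nz : forall j, p j ^+ 2 + q j ^+ 2 != 0.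
Hypothesis det : forall i j, i != j -> across i j != 0.

Definition centered S E := exists z : T1 * T1,
  forall j, j \in S -> aeq (E j) (ctr_itv (lform j z) (half E j)).

(** With [E k] redundant, the other sets are centered by induction if there are at least three of
    them and by the sumset argument if there are two; [boundary_interval] then adds [E k]. *)
Lemma core_interval k S E (x : T1 * T1) :
  ((3 <= #|(S :\ k)%SET|)%N -> adm (S :\ k) (half E) ->
    vol (S :\ k) E = vol (S :\ k) (sym (half E)) -> centered (S :\ k) E) ->
  (3 <= #|S|)%N -> k \in S -> (forall j, finite_borel (E j)) ->
  adm (S :\ k) (half E) ->
  lform k x = half E k -> (forall j, j \in S :\ k -> `|lform j x| <= half E j) ->
  vol S E = vol (S :\ k) E -> vol (S :\ k) E = vol (S :\ k) (sym (half E)) ->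
  centered S E.
Proof.
move=> IH S3 kS fE aJ xk xJ eqv eqJ.
have J2 : (2 <= #|(S :\ k)%SET|)%N by move: S3; rewrite (cardsD1 k S) kS.
have [i [j [iJ jJ ij]]] : exists i j, [/\ i \in S :\ k, j \in S :\ k & i != j].
  by case/card_gt1P: J2 => i [j [iJ jJ ij]]; exists i, j.
have J0 : exists j, j \in S :\ k by exists i.
have pos l : l \in S :\ k -> 0 < mass (E l).
  by move=> /aJ[]; rewrite /half pmulr_lgt0 ?invr_gt0.
have [z zJ] : centered (S :\ k) E.
  have [J3|] := leqP 3 #|(S :\ k)%SET|; first exact: IH.
  rewrite ltnS => J2'.
  apply: (pair_intervals nz det kS iJ jJ ij _ fE (pos i iJ) (pos j jJ) xk xJ eqv).
  move=> l lJ; have [->|li] := eqVneq l i; first by left.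
  have [->|lj] := eqVneq l j; first by right.
  exfalso; suff : (2 < #|(S :\ k)%SET|)%N by rewrite ltnNge J2'.
  by apply/card_gt2P; exists l, i, j; split; split => //; rewrite eq_sym.
exists z => l lS; have [->|lk] := eqVneq l k; last by apply: zJ; rewrite !inE lk.
have h0 : 0 <= half E k by rewrite /half divr_ge0// mass_ge0.
have mk : mass (E k) = 2 * half E k by rewrite /half mulrC divfK.
have posh m : m \in S :\ k -> 0 < half E m by case/aJ.
exact: (boundary_interval nz det kS J0 fE posh h0 mk zJ xk xJ eqv
  (vol_fin nz det iJ jJ ij fE)).
Qed.

Lemma adm_eq S h h' : (forall j, j \in S -> h j = h' j) -> adm S h -> adm S h'.
Proof.
move=> hh' aS k kS; have [h0 [x [xk xS]]] := aS k kS.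
rewrite -hh'//; split => //; exists x; split; rewrite -?hh'// => j jS.
by rewrite -hh'// xS.
Qed.

(** Trimming makes [E k] redundant, and the slice at [s = half E k], nonempty at full depth,
    supplies the boundary point [x] that [core_interval] asks for. *)
Lemma centered_trim k S T E D U :
  (forall E' : I -> set T1, (3 <= #|(S :\ k)%SET|)%N ->
    (forall j, finite_borel (E' j)) -> adm (S :\ k) (half E') ->
    vol (S :\ k) E' = vol (S :\ k) (sym (half E')) -> centered (S :\ k) E') ->
  (3 <= #|S|)%N -> k \in S -> (forall j, finite_borel (E j)) ->
  adm S (half E) -> vol S E = vol S (sym (half E)) ->
  full_depth k (S :\ k) (half E) T -> trimming k (S :\ k) T E D U ->
  (forall j, j \in S :\ k -> 0 < shrink k T (half E) j) ->
  centered S (trim k E D U).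
Proof.
move=> IH S3 kS fE aS eqE fT tr pos.
have J0 : exists j, j \in S :\ k.
  have : (1 < #|(S :\ k)%SET|)%N by move: S3; rewrite (cardsD1 k S) kS.
  by case/card_gt1P => i [j [iJ _ _]]; exists i.
have cT : critical_depth p q k (S :\ k) (half E) T by case: fT.
have [e1 e2] := trimming_equality nz det kS J0 fE cT tr eqE.
have fE' := finite_borel_trim tr fE.
have kJ : k \notin (S :\ k)%SET by rewrite !inE eqxx.
have hE' := half_trim tr kJ.
have hk : half (trim k E D U) k = half E k by rewrite /half /trim eqxx.
have aJ : adm (S :\ k) (half (trim k E D U)).
  apply: (@adm_eq _ (shrink k T (half E))); first by move=> j /hE' ->.
  exact: adm_shrink.
have h0 := (aS k kS).1.
have [||t xJ] := @shrink_slice _ _ p q nz k (S :\ k) (half E) T (half E k) J0 _ fT.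
- by move=> j; exact: across_neq0.
- by rewrite gtr0_norm.
set x := pt p q k (half E k) t in xJ.
have xk : lform k x = half (trim k E D U) k.
  by rewrite hk /x lform_pt ?alongk ?acrossk ?mul0r ?addr0 ?mul1r.
have xJ' j : j \in S :\ k -> `|lform j x| <= half (trim k E D U) j.
  by move=> jJ; rewrite (hE' j jJ); exact: xJ.
apply: (@core_interval k S _ x _ S3 kS fE' aJ xk xJ' e1 e2) => J3 aJ'.
exact: IH.
Qed.

(** The removed tails are open rays, so what remains is exactly the concentric closed interval and
    not merely a set equal to it up to null sets. *)
Lemma itv_trimming k J T (c h : I -> R) E :
  0 <= T -> (forall j, j \in J -> T * `|across k j| <= h j) ->
  (forall j, j \in J -> E j = ctr_itv (c j) (h j)) ->
  exists D U, trimming k J T E D U /\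
    forall j, j \in J -> E j `\` (D j `|` U j) = ctr_itv (c j) (shrink k T h j).
Proof.
move=> T0 Th EJ.
pose D j : set T1 := `]-oo, (c j - h j + T * `|across k j|)[%classic.
pose U j : set T1 := `](c j + h j - T * `|across k j|), +oo[%classic.
have main j : j \in J -> E j `\` (D j `|` U j) = ctr_itv (c j) (shrink k T h j).
  move=> jJ; rewrite EJ// /D /U /ctr_itv.
  apply/seteqP; split=> x; rewrite /= !in_itv /= andbT.
    move=> [/andP[x1 x2]] /not_orP[/negP + /negP]; rewrite -!leNgt => x3 x4.
    by rewrite /shrink; apply/andP; split; lra.
  rewrite /shrink => /andP[x1 x2]; have := Th j jJ.
  have : 0 <= T * `|across k j| by rewrite mulr_ge0.
  move=> b1 b2; split; first by apply/andP; split; lra.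
  by apply/not_orP; split; apply/negP; rewrite -leNgt; lra.
exists D, U; split => // j; split.
- exact: measurable_itv.
- exact: measurable_itv.
- by move=> x y; rewrite /D /= !in_itv /= => yd xy; exact: le_lt_trans yd.
- by move=> x y; rewrite /U /= !in_itv /= !andbT => xd; exact: lt_le_trans.
move=> jJ; have b2 := Th j jJ.
have b1 : 0 <= T * `|across k j| by rewrite mulr_ge0.
split.
- have -> : E j `&` D j = `[c j - h j, c j - h j + T * `|across k j|[%classic.
    rewrite EJ// /D /ctr_itv; apply/seteqP; split=> x; rewrite /= !in_itv /=.
      by move=> [/andP[-> _] ->].
    by move=> /andP[x1 x2]; split=> //; apply/andP; split; lra.
  rewrite (@mass_itv _ _ (c j - h j) (c j - h j + T * `|across k j|) true true)//.
    lra.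
  by lra.
- have -> : E j `&` U j = `]c j + h j - T * `|across k j|, c j + h j]%classic.
    rewrite EJ// /U /ctr_itv; apply/seteqP; split=> x; rewrite /= !in_itv /= andbT.
      by move=> [/andP[_ ->] ->].
    by move=> /andP[x1 x2]; split=> //; apply/andP; split; lra.
  rewrite (@mass_itv _ _ (c j + h j - T * `|across k j|) (c j + h j) false false)//.
    lra.
  by lra.
- rewrite main// EJ// !mass_ctr /shrink; lra.
Qed.

(* Trimming along [k] leaves [E k] unchanged, so applying [centered_trim] for
   every [k] shows that each [E k] is an interval; the intervals are then trimmed
   explicitly in order to compare their centers. *)
Theorem equality_centered S E : (3 <= #|S|)%N -> (forall j, finite_borel (E j)) ->
  adm S (half E) -> vol S E = vol S (sym (half E)) -> centered S E.
Proof.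
move: {2}#|S| (leqnn #|S|) E => m; elim: m S => [|m IHm] S Sm E S3 fE aS eqE.
  by move: (leq_trans S3 Sm).
have IH k : k \in S -> forall E' : I -> set T1, (3 <= #|(S :\ k)%SET|)%N ->
    (forall j, finite_borel (E' j)) -> adm (S :\ k) (half E') ->
    vol (S :\ k) E' = vol (S :\ k) (sym (half E')) -> centered (S :\ k) E'.
  by move=> kS E' *; apply: IHm => //; move: Sm; rewrite (cardsD1 k S) kS.
have h0 j : 0 <= half E j by rewrite /half divr_ge0// mass_ge0.
have third k j : k \in S -> j \in S :\ k -> exists i, [/\ i \in S :\ k & i != j].
  move=> kS jJ; have : (1 < #|(S :\ k)%SET|)%N by move: S3; rewrite (cardsD1 k S) kS.
  case/card_gt1P => a [b [aJ bJ ab]]; have [aj|aj] := eqVneq a j; last by exists a.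
  by exists b; rewrite -aj eq_sym.
have J0 k : k \in S -> exists j, j \in S :\ k.
  move=> kS; have : (1 < #|(S :\ k)%SET|)%N by move: S3; rewrite (cardsD1 k S) kS.
  by case/card_gt1P => a [b [aJ _ _]]; exists a.
have depth k : k \in S -> exists T, full_depth k (S :\ k) (half E) T.
  move=> kS; have [T cT] := critical_depth_exists p q k (half E) (J0 k kS).
  by exists T; apply: full_depthP cT.
have b0 k j : j \in S :\ k -> across k j != 0 by exact: across_neq0.
(* At depth 0 the trimmed sets are the original ones, and one application of [centered_trim] settles
   all indices. *)
have [[k [kS fT]]|noT0] :=
    pselect (exists k, k \in S /\ full_depth k (S :\ k) (half E) 0).
  have tr : trimming k (S :\ k) 0 E (fun=> set0) (fun=> set0).
    move=> j; split;
      [exact: measurable0|exact: measurable0|by move=> x y|by move=> x y|].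
    by move=> _; rewrite mul0r mulr0 subr0 setI0 setU0 setD0 /mass measure0.
  have := centered_trim (IH k kS) S3 kS fE aS eqE fT tr.
  have -> : trim k E (fun=> set0) (fun=> set0) = E.
    by apply/funext => j; rewrite /trim setU0 setD0 if_same.
  apply=> j; rewrite /shrink mul0r subr0 !inE => /andP[_ jS].
  exact: (aS j jS).1.
have T_gt0 k T : k \in S -> full_depth k (S :\ k) (half E) T -> 0 < T.
  move=> kS fT; rewrite lt_neqAle eq_sym; apply/andP; split; last by case: fT.
  by apply/eqP => T0; apply: noT0; exists k; rewrite -T0.
(* A third index [i], also of positive depth, keeps the half-width of [j] positive. *)
have pos k T : k \in S -> full_depth k (S :\ k) (half E) T ->
    forall j, j \in S :\ k -> 0 < shrink k T (half E) j.
  move=> kS fT j jJ; have [i [iJ ij]] := third k j kS jJ.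
  have iS : i \in S by move: iJ; rewrite !inE => /andP[].
  have [Ti fTi] := depth i iS.
  exact: (shrink_gt0 nz det aS kS fT iJ jJ ij fTi (T_gt0 i Ti iS fTi)).
have TE k T : k \in S -> full_depth k (S :\ k) (half E) T ->
    forall j, j \in S :\ k -> T * `|across k j| <= half E j.
  move=> kS [_ _ cT] j jJ; exact: (critical_depth_le cT jJ (h0 j) (b0 k j jJ)).
have : forall k, exists c, k \in S -> aeq (E k) (ctr_itv c (half E k)).
  move=> k; have [kS|] := boolP (k \in S); last by exists 0.
  have [T fT] := depth k kS; have T0 := T_gt0 k T kS fT.
  have [D [U tr]] := trimming_exists fE (ltW T0) (TE k T kS fT).
  have [z zS] := centered_trim (IH k kS) S3 kS fE aS eqE fT tr (pos k T kS fT).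
  exists (lform k z) => _; have := zS k kS.
  by rewrite /half /trim eqxx.
case/choice => c cE.
(* The sets are now replaced by the intervals found, with the same volume, so that a single explicit
   trimming can exhibit all centers for one [z]. *)
pose C j := if j \in S then ctr_itv (c j) (half E j) else E j.
have fC j : finite_borel (C j).
  by rewrite /C; case: ifP => // _; exact: finite_borel_ctr.
have mE j : measurable (E j) by case: (fE j).
have mC j : measurable (C j) by case: (fC j).
have hC : half C = half E.
  apply/funext => j; rewrite {1}/half /C; case: ifP => // _.
  by rewrite mass_ctr// mulrC mulKf.
have EC j : j \in S -> aeq (E j) (C j) by move=> jS; rewrite /C jS; exact: cE.
have eqC : vol S C = vol S (sym (half C)).
  by rewrite hC -eqE; apply: vol_aeq => // j jS; apply/aeq_sym/EC.
have [k kS] : exists k, k \in S.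
  have /card_gt0P[k kS] : (0 < #|S|)%N := leq_trans (isT : 0 < 3)%N S3.
  by exists k.
have [T fT] := depth k kS; have T0 := ltW (T_gt0 k T kS fT).
have CJ j : j \in S :\ k -> C j = ctr_itv (c j) (half E j).
  by rewrite !inE /C => /andP[_ ->].
have [D [U [tr CT]]] := itv_trimming T0 (TE k T kS fT) CJ.
rewrite -hC in aS fT.
have posC j : j \in S :\ k -> 0 < shrink k T (half C) j.
  by rewrite hC; apply: (pos k T kS); rewrite -hC.
have [z zS] := centered_trim (IH k kS) S3 kS fC aS eqC fT tr posC.
have kJ : k \notin (S :\ k)%SET by rewrite !inE eqxx.
(* The interval of index [j], trimmed or not, is centered both at [c j] and at [lform j z], and an
   interval of positive length has one center. *)
exists z => j jS; suff <- : c j = lform j z by exact: cE.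
have := zS j jS; have [->|jk] := eqVneq j k.
  rewrite /half {1 2}/trim eqxx -/(half C k) hC /C kS; apply: ctr_itv_inj.
  by have := (aS k kS).1; rewrite hC.
have jJ : j \in S :\ k by rewrite !inE jk.
rewrite (half_trim tr)// hC {1}/trim (negbTE jk) CT//; apply: ctr_itv_inj.
by rewrite -hC posC.
Qed.

End equality_theorem.

(** * From Lebesgue measurable sets to Borel sets *)

(** [X] lies between [B] and [B] enlarged by a null set, so it is measurable for the completed
    measure and has the measure of [B]. *)
Lemma integral_indic_completion d (T : measurableType d) (R : realType)
    (m : {measure set T -> \bar R}) (B N X : set T) :
  measurable B -> measurable N -> m N = 0%E -> B `<=` X -> X `<=` B `|` N ->
  (\int[@completed_measure_extension _ _ R m]_x
     (\1_(X : set (caratheodory_type (m^*)%mu)) x)%:E)%E = m B.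
Proof.
move=> mB mN N0 BX XBN.
have mN' := caratheodory_measurable_mu_ext m mN.
have mB' := caratheodory_measurable_mu_ext m mB.
have XB : (m^*)%mu.-cara.-measurable (X `\` B).
  apply: measure_is_complete_caratheodory; exists N; split => //.
    by rewrite -N0; exact: measurable_mu_extE.
  by move=> x [Xx Bx]; case: (XBN x Xx).
have XE : X = B `|` (X `\` B).
  apply/seteqP; split=> x; last by case=> [/BX|[]].
  by have [?|?] := pselect (B x); [left|right].
have mX : (m^*)%mu.-cara.-measurable X by rewrite XE; exact: measurableU.
rewrite integral_indic// setIT; apply/eqP; rewrite eq_le; apply/andP; split.
  have : ((m^*)%mu X <= (m^*)%mu (B `|` N))%E by exact: le_outer_measure.
  rewrite [X in (_ <= X)%E]measurable_mu_extE; last exact: measurableU.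
  have : (m (B `|` N) <= m B + m N)%E by exact: measureU2.
  by rewrite N0 adde0 => h2 h1; exact: le_trans h1 h2.
have : ((m^*)%mu B <= (m^*)%mu X)%E by exact: le_outer_measure.
by rewrite measurable_mu_extE.
Qed.

Section completion.
Context {R : realType}.
Local Notation mu := (@lebesgue_measure R).
Local Notation cmu := (@completed_lebesgue_measure R).
Local Notation T1 := (measurableTypeR R).
Implicit Types A B N : set T1.

(** [B] is a Borel subset of [E] of full measure, and [N] a Borel null set covering the rest; Fubini
    for the product measure is applied to [B]. *)
Definition borel_core B E N :=
  [/\ measurable B, measurable N, mu N = 0%E, B `<=` E & E `<=` B `|` N].

Lemma cmu_borel A : cmu A = mu A.
Proof. by []. Qed.

Lemma cmuS A B : A `<=` B -> (cmu A <= cmu B)%E.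
Proof. by move=> AB; exact: le_outer_measure. Qed.

Lemma cmu_null A N : A `<=` N -> mu N = 0%E -> cmu A = 0%E.
Proof.
move=> AN N0; apply/eqP; rewrite eq_le outer_measure_ge0 andbT -N0.
exact: cmuS.
Qed.

Lemma lebesgue_measurable_core (E : set R) : lebesgue_measurable E ->
  exists B N, borel_core B E N.
Proof.
rewrite /lebesgue_measurable -completed_caratheodory_measurable.
rewrite g_sigma_completed_algebra_genE => -[B mB [M [N [mN N0 MN]]] <-].
by exists B, N; split => // x [Bx|/MN]; [left|right].
Qed.

Lemma core_measure B E N : borel_core B E N -> cmu E = mu B.
Proof.
move=> [mB mN N0 BE EBN]; apply/eqP; rewrite eq_le; apply/andP; split.
  apply: (le_trans (cmuS EBN)); rewrite cmu_borel.
  have : (mu (B `|` N) <= mu B + mu N)%E by exact: measureU2.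
  by rewrite N0 adde0.
by rewrite -cmu_borel; exact: cmuS.
Qed.

Lemma core_aeq B E N J : borel_core B E N -> measurable J ->
  cmu (E `+` J) = 0%E <-> aeq B J.
Proof.
move=> [mB mN N0 BE EBN] mJ.
have mBJ : measurable (B `\` J) by exact: measurableD.
have mJB : measurable (J `\` B) by exact: measurableD.
split=> [EJ0|[BJ JB]].
  have sub A : measurable A -> A `<=` E `+` J -> mu A = 0%E.
    move=> mA AEJ; apply/eqP; rewrite eq_le measure_ge0 andbT -EJ0 -cmu_borel.
    exact: cmuS.
  split; first by apply: sub => // x [Bx Jx]; left; split=> //; exact: BE.
  have JBN0 : mu ((J `\` B) `\` N) = 0%E.
    apply: sub; first exact: measurableD.
    move=> x [[Jx Bx] Nx]; right; split=> // Ex.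
    by case: (EBN x Ex).
  apply/negligibleP => //; apply: (@negligibleS _ _ _ _ (((J `\` B) `\` N) `|` N)).
    by move=> x JBx; have [Nx|Nx] := pselect (N x); [right|left].
  by apply: negligibleU; apply/negligibleP => //; exact: measurableD.
have mU : measurable (N `|` ((B `\` J) `|` (J `\` B))).
  by apply: measurableU => //; exact: measurableU.
apply: (@cmu_null _ (N `|` ((B `\` J) `|` (J `\` B)))).
  move=> x [[Ex Jx]|[Jx Ex]].
    by case: (EBN x Ex) => [Bx|Nx]; [right; left|left].
  by right; right; split=> // Bx; apply: Ex; exact: BE.
apply/negligibleP => //; apply: negligibleU; first exact/negligibleP.
by apply: negligibleU; exact/negligibleP.
Qed.

(** Whatever its kind, [J] differs from the closed interval between [inf J] and [sup J] by at most
    these two points. *)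
Lemma interval_aeq_ctr (c : R) (J : set R) : interval_centered_at c J ->
  exists2 r, 0 <= r & measurable (J : set T1) /\ aeq (J : set T1) (ctr_itv c r).
Proof.
move=> [iJ [[x Jx] lJ] [_ uJ] cE].
have mJ : measurable (J : set T1) by exact: is_interval_measurable.
have iJx : inf J <= x by exact: ge_inf.
have xsJ : x <= sup J by exact: ub_le_sup.
have cl : c - (sup J - inf J) / 2 = inf J by rewrite cE; field.
have cu : c + (sup J - inf J) / 2 = sup J by rewrite cE; field.
exists ((sup J - inf J) / 2); first by rewrite divr_ge0// subr_ge0 (le_trans iJx).
split=> //; have mc := (finite_borel_ctr c ((sup J - inf J) / 2)).1.
split.
  suff -> : (J : set T1) `\` ctr_itv c ((sup J - inf J) / 2) = set0.
    by rewrite measure0.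
  apply/seteqP; split=> // y [Jy]; apply; rewrite /ctr_itv cl cu /= in_itv /=.
  by apply/andP; split; [exact: ge_inf|exact: ub_le_sup].
apply/negligibleP; first exact: measurableD.
apply: (@negligibleS _ _ _ _ ([set inf J] `|` [set sup J] : set T1)); last first.
  by apply: negligibleU; apply/negligibleP;
    [exact: measurable_set1|exact: lebesgue_measure_set1|
     exact: measurable_set1|exact: lebesgue_measure_set1].
move=> y [+ Jy]; rewrite /ctr_itv cl cu /= in_itv /= => /andP[y1 y2].
apply: contrapT => /not_orP[/eqP yi /eqP ys]; apply: Jy.
have iy : inf J < y by rewrite lt_neqAle eq_sym yi.
have ys' : y < sup J by rewrite lt_neqAle ys.
have [u Ju uy] := inf_lt (ex_intro _ x Jx) iy.
have [v Jv yv] := sup_gt (ex_intro _ x Jx) ys'.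
by apply: (iJ u v) => //; rewrite !ltW.
Qed.

Lemma ctr_itv_centered (c r : R) : 0 <= r -> interval_centered_at c (ctr_itv c r).
Proof.
move=> r0; have cr : c - r <= c + r by lra.
rewrite /ctr_itv; split.
- by move=> x y /= + + z /andP[xz zy]; rewrite !in_itv /= => /andP[xl _] /andP[_ yu];
    rewrite (le_trans xl xz) (le_trans zy yu).
- split; first by exists c; rewrite /= in_itv /=; apply/andP; split; lra.
  by exists (c - r) => x /=; rewrite in_itv /= => /andP[].
- split; first by exists c; rewrite /= in_itv /=; apply/andP; split; lra.
  by exists (c + r) => x /=; rewrite in_itv /= => /andP[].
- by rewrite inf_itvcc// sup_itvcc//; field.
Qed.

End completion.

(** * The multilinear form as the volume of an intersection of slabs *)

Section multiform.
Context {R : realType} {n : nat}.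
Local Notation mu := (@lebesgue_measure R).
Local Notation mu2 := (@lebesgue_measure R \x @lebesgue_measure R)%E.
Local Notation T1 := (measurableTypeR R).
Variable L : 'I_n -> {linear plane R -> R^o}.

Definition coef1 (j : 'I_n) : R := L j (1, 0).
Definition coef2 (j : 'I_n) : R := L j (0, 1).

Local Notation lform := (lform coef1 coef2).
Local Notation slab := (slab coef1 coef2).
Local Notation vol := (vol coef1 coef2).

Lemma lformE j (x : plane R) : L j x = lform j x.
Proof.
have -> : x = x.1 *: ((1, 0) : plane R) + x.2 *: ((0, 1) : plane R).
  case: x => a b; congr pair => /=.
    by rewrite /GRing.scale /= mulr1 mulr0 addr0.
  by rewrite /GRing.scale /= mulr1 mulr0 add0r.
rewrite linearD !linearZ /= /lform /coef1 /coef2 /=.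
by rewrite /GRing.scale /= !mulr1 !mulr0 addr0 add0r mulrC [in X in _ + X]mulrC.
Qed.

Lemma coef_neq0 : (forall i (y : R), exists x, L i x = y) ->
  forall j, coef1 j ^+ 2 + coef2 j ^+ 2 != 0.
Proof.
move=> Ls j; have [x] := Ls j 1; rewrite lformE /lform => H.
apply/eqP => pq; suff [p0 q0] : coef1 j = 0 /\ coef2 j = 0.
  by move: H; rewrite p0 q0 !mul0r addr0 => /esym/eqP; rewrite oner_eq0.
have := sqr_ge0 (coef1 j); have := sqr_ge0 (coef2 j) => h1 h2.
by split; apply/eqP; rewrite -sqrf_eq0; apply/eqP; lra.
Qed.

Lemma across_coef_neq0 : (forall i (y : R), exists x, L i x = y) ->
  nondegenerate_family L ->
  forall i j, i != j -> across coef1 coef2 i j != 0.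
Proof.
move=> Ls Ln i j ij; apply/eqP => d0.
have nz := coef_neq0 Ls i.
have S2 : #|[set i; j]%SET| = 2%N by rewrite cards2 ij.
have /bij_inj inj := Ln _ S2.
(* The kernel of [L i] is spanned by [x]; a vanishing determinant makes [L j] vanish there too,
   against injectivity. *)
pose x : plane R := (- coef2 i, coef1 i).
have : x = 0.
  apply: inj; apply/ffunP => -[l lS]; rewrite !ffunE /= linear0 lformE.
  move: lS; rewrite !inE => /orP[/eqP ->|/eqP ->].
    by rewrite /lform /x /=; ring.
  by rewrite -[RHS]d0 /lform /x /across /=; ring.
case=> q0 p0; move: nz; rewrite p0 -[coef2 i]opprK q0 oppr0 expr0n addr0.
by rewrite eqxx.
Qed.

Hypothesis nz : forall j, coef1 j ^+ 2 + coef2 j ^+ 2 != 0.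

(** The product of indicators is the indicator of the intersection of the slabs over [E], which lies
    between those over [B] and over [B] enlarged by [N]; these two differ by a null set. *)
Lemma multiform_vol (E : 'I_n -> set R) (B N : 'I_n -> set T1) :
  (forall j, borel_core (B j) (E j) (N j)) ->
  multiform L E = vol [set: 'I_n]%SET B.
Proof.
move=> core.
have mB j : measurable (B j) by case: (core j).
have mN j : measurable (N j) by case: (core j).
have mBN j : measurable (B j `|` N j) by exact: measurableU.
pose X := slab [set: 'I_n]%SET E.
have BX : slab [set: 'I_n]%SET B `<=` X.
  by move=> z zB j jn; case: (core j) => _ _ _ BE _; apply: BE; exact: zB.
have XBN : X `<=` slab [set: 'I_n]%SET (fun j => B j `|` N j).
  by move=> z zX j jn; case: (core j) => _ _ _ _ EBN; apply: EBN; exact: zX.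
have mS := measurable_slab coef1 coef2 [set: 'I_n]%SET mB.
have mS' := measurable_slab coef1 coef2 [set: 'I_n]%SET mBN.
rewrite /multiform.
transitivity (\int[lebesgue_measure2]_x
    (\1_(X : set (caratheodory_type (mu2^*)%mu)) x)%:E)%E.
  apply: eq_integral => x _; congr EFin; rewrite indicE.
  have [xX|xX] := pselect (X x).
    rewrite mem_set//= big1// => j _; rewrite indicE mem_set//.
    by rewrite lformE; apply: xX; rewrite /= inE.
  rewrite memNset//=; move/existsNP: xX => [j /not_implyP[_ xj]].
  by rewrite (bigD1 j)//= indicE memNset ?mul0r// lformE.
apply: (integral_indic_completion mS (measurableD mS' mS)) => //.
  apply: slab_null => // j _; have [_ _ N0 _ _] := core j.
  apply: (subset_measure0 _ (mN j)) => //; first exact: measurableD.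
  by move=> x [[//|]].
by move=> z /XBN zS; have [?|?] := pselect (slab [set: 'I_n]%SET B z); [left|right].
Qed.

End multiform.

(** * Translation, admissibility, and the proof of the theorem *)

Lemma vol_translate (R : realType) (I : finType) (p q : I -> R) (S : {set I})
    (h : I -> R) (z : R * R) :
  vol p q S (fun j => ctr_itv (lform p q j z) (h j)) = vol p q S (sym h).
Proof.
have mC j : measurable (ctr_itv (lform p q j z) (h j)) by exact: measurable_itv.
have mS := measurable_slab p q S mC.
have d1 : (1 : R) * 1 - 0 * 0 != 0 by rewrite mul1r mul0r subr0 oner_neq0.
have := mu2_affine z.1 z.2 d1 mS.
rewrite mul1r mul0r subr0 normr1 invr1 mul1e => H; rewrite /vol -H {H}.
congr (product_measure1 _ _ _); apply/seteqP.
have E (j : I) (w : R * R) : sym h j (lform p q j w) <->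
    ctr_itv (lform p q j z) (h j)
      (lform p q j (z.1 + 1 * w.1 + 0 * w.2, z.2 + 0 * w.1 + 1 * w.2)).
  rewrite ctr_itvP /sym /= in_itv /= -ler_norml.
  suff -> : lform p q j (z.1 + 1 * w.1 + 0 * w.2, z.2 + 0 * w.1 + 1 * w.2) -
    lform p q j z = lform p q j w by [].
  by rewrite /lform /=; ring.
by split=> w H j jS; apply/E; exact: H.
Qed.

Lemma rearrangementE (R : realType) (n : nat) (E B N : 'I_n -> set R) j :
  borel_core (B j) (E j) (N j) -> rearrangement (E j) = sym (half B) j.
Proof. by move=> core; rewrite /rearrangement (core_measure core). Qed.

(** If the line of index [k] missed the polygon, the open strip [|L k x| < half B k] would contain
    the intersection of the other strips, which admissibility forbids. *)
Lemma admissible_adm (R : realType) (n : nat)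
    (L : 'I_n -> {linear plane R -> R^o}) (E B N : 'I_n -> set R) :
  (forall j, borel_core (B j) (E j) (N j)) -> admissible L E ->
  adm (coef1 L) (coef2 L) [set: 'I_n]%SET (half B).
Proof.
move=> core [Efin Eadm] k _.
have hE j : half B j = fine (completed_lebesgue_measure (E j)) / 2.
  by rewrite (core_measure (core j)).
have h0 j : 0 < half B j.
  rewrite hE divr_gt0//; apply: fine_gt0.
  by have [_ -> ->] := Efin j.
split=> //; apply: contrapT => noedge; apply: Eadm.
have stripE j x : strip L E j x <-> `|L j x| <= half B j.
  by rewrite /strip /= (rearrangementE (core j)) /sym /= in_itv /= ler_norml.
exists k, [set x : plane R | `|L k x| < half B k]; split.
- have cL : continuous (fun x : plane R => `|L k x| : R).
    have -> : (fun x : plane R => `|L k x| : R) =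
        (fun x : plane R => `|coef1 L k * (x.1 : R) + coef2 L k * (x.2 : R)|).
      by apply/funext => x; rewrite lformE.
    move=> x; apply: cvg_norm; apply: cvgD; apply: cvgMr.
      exact: cvg_fst.
    exact: cvg_snd.
  exact: (@open_comp _ _ (fun x : plane R => `|L k x| : R) [set y | y < half B k]
     (fun x _ => cL x) (@open_lt R (half B k))).
- move=> x xS; rewrite /= ltNge; apply/negP => hk; apply: noedge.
  have xk0 : 0 < `|L k x| by apply: lt_le_trans hk.
  (* The strips are convex and symmetric: scaling [x] by [a], with [|a| <= 1] and the sign of
     [L k x], moves it onto the line [L k = half B k] without leaving the other strips. *)
  pose a := half B k / L k x.
  have Lk0 : L k x != 0 by rewrite -normr_gt0.
  have a1 : `|a| <= 1.
    by rewrite /a normrM normfV (gtr0_norm (h0 k)) ler_pdivrMr// mul1r.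
  exists (a * x.1, a * x.2).
  have aE j : lform (coef1 L) (coef2 L) j (a * x.1, a * x.2) = a * L j x.
    by rewrite lformE /lform /=; ring.
  split; first by rewrite aE /a divfK.
  move=> j _; rewrite aE normrM; have [->|jk] := eqVneq j k.
    by rewrite /a -normrM divfK// gtr0_norm.
  apply: (@le_trans _ _ (1 * `|L j x|)); first by apply: ler_wpM2r.
  by rewrite mul1r; apply/stripE; exact: xS.
- by move=> x /= xk; apply/stripE; exact: ltW.
Qed.

Theorem theorem1 (R : realType) (n : nat) (hn : (3 <= n)%N)
    (L : 'I_n -> {linear plane R -> R^o})
    (L_surj : forall i (y : R), exists x, L i x = y)
    (L_nondeg : nondegenerate_family L)
    (E : 'I_n -> set R)
    (E_adm : admissible L E) :
  multiform L E = multiform L (fun i => rearrangement (E i)) <->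
  exists (z : plane R) (J : 'I_n -> set R), forall i,
    interval_centered_at (L i z) (J i) /\
    completed_lebesgue_measure (E i `+` J i) = 0%E.
Proof.
have nz := coef_neq0 L_surj; have det := across_coef_neq0 L_surj L_nondeg.
have : forall j, exists BN : set (measurableTypeR R) * set (measurableTypeR R),
    borel_core BN.1 (E j) BN.2.
  move=> j; have [mE _ _] := E_adm.1 j.
  by have [B [N core]] := lebesgue_measurable_core mE; exists (B, N).
case/choice => BN core0.
pose B j := (BN j).1; pose N j := (BN j).2.
have core j : borel_core (B j) (E j) (N j) := core0 j.
have fB j : finite_borel (B j).
  have [_ _ Efin] := E_adm.1 j; split; first by case: (core j).
  by rewrite -(core_measure (core j)).
have h0 j : 0 <= half B j by rewrite /half divr_ge0// mass_ge0.
have mB j : measurable (B j) by case: (fB j).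
rewrite (multiform_vol nz core).
(* The rearranged sets are closed intervals, hence their own Borel cores with empty exceptional
   sets. *)
rewrite (@multiform_vol R n L nz _ (sym (half B)) (fun=> set0)); last first.
  move=> j; rewrite (rearrangementE (core j)).
  by split => //; exact: measurable_sym.
split.
  have aB := admissible_adm core E_adm.
  move=> eqv; have [|z zS] := equality_centered nz det _ fB aB eqv.
    by rewrite cardsT card_ord.
  exists z, (fun j => ctr_itv (L j z) (half B j)) => j; split.
    exact: ctr_itv_centered.
  apply/(core_aeq (core j)); first exact: measurable_itv.
  by rewrite lformE; apply: zS; rewrite inE.
move=> [z [J zJ]].
have aB j : aeq (B j) (ctr_itv (lform (coef1 L) (coef2 L) j z) (half B j)).
  have [/interval_aeq_ctr[r r0 [mJ Jr]]] := zJ j.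
  move=> /(core_aeq (core j) mJ) BJ.
  have fr := finite_borel_ctr (L j z) r.
  have Br := aeq_trans (mB j) mJ fr.1 BJ Jr.
  (* The given interval has the mass of [B j], which fixes its radius; with all centers at [L j z]
     the configuration is a translate of the symmetric one. *)
  have <- : r = half B j.
    by rewrite /half (aeq_mass (fB j) fr Br) mass_ctr// mulrC mulKf.
  by rewrite -lformE.
rewrite -(vol_translate _ _ _ _ z); apply: vol_aeq => // j.
exact: measurable_itv.
Qed.
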